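(* Let $c>0$, let $Q$ be the stationary queueing process driven by a standard Brownian motion ($H=1/2$) with service rate $c$, and let $0\le T_1<T_2$ and $x\ge 0$ satisfy $T_2-T_1>x$. Let $w\in\mathbb{R}$ and let $\omega(u)=u+w+o(1)$ as $u\to\infty$. Then $$\mathbb{P}\left\{\int_{T_1}^{T_2}\mathbb{I}(Q(t)>\omega(u))\,dt>x\;\Big|\;Q(0)>u\right\}\sim e^{-2cw}\,\mathcal{C}(T_1,T_2,x;w),\qquad u\to\infty.$$
   Context: $B_{1/2}(t)$, $t\in\mathbb{R}$, is a standard two-sided Brownian motion (fractional Brownian motion with Hurst index $1/2$). The stationary queueing (workload) process with rate $c>0$ is, in law, $$\{Q(t),t\ge 0\}\stackrel{d}{=}\Big\{\sup_{s\ge t}\big(B_{1/2}(s)-B_{1/2}(t)-c(s-t)\big),\ t\ge 0\Big\};$$ it is the unique stationary solution of $Q(t)=B_{1/2}(t)-ct+\max\big(Q(0),-\inf_{s\in[0,t]}(B_{1/2}(s)-cs)\big)$, $t\ge0$. $\mathbb{I}(\cdot)$ is the indicator function, and $f(u)\sim g(u)$ means $f(u)/g(u)\to1$ as $u\to\infty$. For $T_2-T_1>x\ge0$ and $w\in\mathbb{R}$, $$\mathcal{C}(T_1,T_2,x;w)=2c\int_{-\infty}^{w}e^{2cy}\,\mathbb{P}\left\{\int_{T_1}^{T_2}\mathbb{I}\big(B_{1/2}(t)-ct>y\big)\,dt>x\right\}dy\in(0,\infty).$$ *)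

(* Defs.v *)
From HB Require Import structures.
From mathcomp Require Import all_boot all_order all_algebra.
From mathcomp Require Import all_classical all_reals all_analysis.
From mathcomp Require Import measurable_realfun.

Set Implicit Arguments.
Unset Strict Implicit.
Unset Printing Implicit Defensive.

Import Order.TTheory GRing.Theory Num.Theory.
Import numFieldNormedType.Exports.

Local Open Scope classical_set_scope.
Local Open Scope ring_scope.

(* Independence is stated on consecutive increments along an increasing grid of
   (possibly negative) times; taking [A i = setT] gives every subfamily. The
   second parameter of [normal_prob] is the standard deviation. *)
Definition two_sided_brownian_motion (R : realType) (d : measure_display)
    (T : measurableType d) (P : probability T R) (B : R -> {RV P >-> R}) : Prop :=
  [/\ forall o, B 0 o = 0,
      forall o, continuous (fun t => B t o : R),
      forall s t (A : set R), s < t -> measurable A ->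
        P [set o | A (B t o - B s o)] = normal_prob 0 (Num.sqrt (t - s)) A
    & forall (n : nat) (t : nat -> R) (A : nat -> set R),
        (forall i, t i < t i.+1) -> (forall i, measurable (A i)) ->
        P [set o | forall i, (i < n)%N -> A i (B (t i.+1) o - B (t i) o)] =
        (\prod_(i < n) P [set o | A i (B (t i.+1) o - B (t i) o)%R])%E].

(* Extended-real valued, because the supremum may be infinite on a null set. *)
Definition workload (R : realType) (T : Type) (B : R -> T -> R) (c : R)
    (t : R) (o : T) : \bar R :=
  ereal_sup [set (B s o - B t o - c * (s - t))%:E | s in [set s | t <= s]].

(* The product (Kolmogorov) sigma-algebra of \bar R ^ D. *)
Definition path_measurable (R : realType) (D : set R) :
    set (set (R -> \bar R)) :=
  <<s [set C | exists t (A : set (\bar R)),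
         [/\ D t, measurable A & C = [set f | A (f t)]]] >>.

Definition equal_in_law (R : realType) (d d' : measure_display)
    (T : measurableType d) (T' : measurableType d')
    (P : probability T R) (P' : probability T' R) (D : set R)
    (X : R -> T -> \bar R) (Y : R -> T' -> \bar R) : Prop :=
  forall C, path_measurable D C ->
    P [set o | C (fun t => X t o)] = P' [set o | C (fun t => Y t o)].

(* Equality in law determines Q only up to modification; path continuity, which
   every solution of the workload equation has, makes its occupation times
   well-defined functionals of the law. *)
Definition stationary_queue (R : realType) (d d' : measure_display)
    (T : measurableType d) (T' : measurableType d')
    (P : probability T R) (P' : probability T' R)
    (B : R -> {RV P >-> R}) (c : R) (Q : R -> {RV P' >-> \bar R}) : Prop :=
  (forall o, {within `[0, +oo[, continuous (fun t => Q t o : \bar R)}) /\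
  equal_in_law P' P `[0, +oo[ Q (workload B c).

Definition occupation_time (R : realType) (T1 T2 : R) (f : R -> \bar R)
    (y : R) : \bar R :=
  (\int[lebesgue_measure]_(t in `[T1, T2]) (\1_[set s | (y%:E < f s)%E] t)%:E)%E.

(* The integral is finite when c > 0; [fine] sends an infinite one to 0. *)
Definition calC (R : realType) (d : measure_display) (T : measurableType d)
    (P : probability T R) (B : R -> {RV P >-> R}) (c T1 T2 x w : R) : R :=
  2 * c * fine (\int[lebesgue_measure]_(y in `]-oo, w])
    ((expR (2 * c * y)%R)%:E *
     P [set o | x%:E < occupation_time T1 T2 (fun t => (B t o - c * t)%R%:E) y]))%E.

Definition cond_prob (R : realType) (d : measure_display)
    (T : measurableType d) (P : probability T R) (A E : set T) : R :=
  fine (P (A `&` E)) / fine (P E).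

(* Main.v *)
Require Import Defs.
From HB Require Import structures.
From mathcomp Require Import all_boot all_order all_algebra.
From mathcomp Require Import all_classical all_reals all_analysis.
From mathcomp Require Import measurable_realfun.
From mathcomp Require Import ring lra.

Set Implicit Arguments.
Unset Strict Implicit.
Unset Printing Implicit Defensive.

Import Order.TTheory GRing.Theory Num.Theory.
Import numFieldNormedType.Exports.

Local Open Scope classical_set_scope.
Local Open Scope ring_scope.

(** Write X(t) = B(t) - c t and T = T2.  The workload at time t is
    W(t) = sup_(s >= t) X(s) - X(t).  Two facts make the limit computable.

    The first is the exponential change of measure for constant drift: on
    [0, T], reweighting by exp (2 c X(T)) turns the law of -X into the law of X
    ([path_girsanov]).  For a single Gaussian increment this is the completion
    of a square ([normal_tilt]); independence of increments carries it to
    dyadic grids ([grid_girsanov]) and a pi-lambda argument to paths.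
    Decomposing on the first passage above u, where the weight is
    exp (-2 c u) up to the overshoot, gives the law of the maximum:
    P (sup_(t >= 0) X(t) > u) = exp (-2 c u) ([ever_exceeds_probability]).
    Hence W(0) and W(T) are exponential with rate 2 c, and the maximum of X
    over the bounded interval [0, T] exceeds u with probability
    o(exp (-2 c u)) only ([exceeds_le], [descent_probability_small]).

    The second is the shape of a high workload.  Let E = W(T), which is
    independent of X on [0, T].  When X stays below u on [0, T] and W(0) > u,
    only the times after T matter for the supremum defining W(t), t <= T, so that
    W(t) = E + X(T) - X(t) on [0, T] ([backlog_before]).  The occupation time
    of W above y = omega u then exceeds x exactly when E + X(T) > y - Z, where Z is the
    supremum of the levels above which -X spends more than x time units.  Up to
    the negligible event above, the event of the statement is therefore
    E > max (u, y - Z) - X(T) ([long_occupation_backlog]).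

    Integrating out the exponential variable E ([probability_backlog_gt]),
    the probability divided by exp (-2 c u) is, up to a vanishing error, the
    expectation of exp (2 c X(T)) exp (-2 c max (0, y - u - Z))
    ([queue_event_le], [queue_event_ge]).  Writing the last exponential as an integral over levels
    and applying the change of measure, which replaces -X by X, identifies this
    number as exp (-2 c v) times the constant C at v = y - u
    ([limit_integralE]).  It is continuous in v ([limit_integral_lipschitz]),
    and v tends to w.

    All path events are handled through countable descriptions on dyadic grids,
    so that pi-lambda arguments transport them between X, its reflection and
    Q. *)

(** * Measures with a density *)


Section weighted_measure.
Context d (T : measurableType d) (R : realType).
Variables (mu : {measure set T -> \bar R}) (w : T -> R).
Hypotheses (mw : measurable_fun setT w) (w0 : forall x, 0 <= w x).

(** The proofs of measurability and nonnegativity are arguments of the set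
    function so that its measure structure can be inferred from the term. *)
Definition weighted of measurable_fun setT w & (forall x, 0 <= w x) :=
  fun A => (\int[mu]_(x in A) (w x)%:E)%E.

Local Notation nu := (weighted mw w0).

Let weighted_set0 : nu set0 = 0%E.
Proof. exact: integral_set0. Qed.

Let weighted_ge0 A : (0 <= nu A)%E.
Proof. by apply: integral_ge0 => x _; rewrite lee_fin; exact: w0. Qed.

Let weighted_additive : semi_sigma_additive nu.
Proof. by apply: semi_sigma_additive_nng_induced => //; exact/measurable_EFinP. Qed.

HB.instance Definition _ :=
  isMeasure.Build _ _ _ nu weighted_set0 weighted_ge0 weighted_additive.

Import HBNNSimple.

Lemma ge0_integral_weighted (f : T -> \bar R) :
  measurable_fun setT f -> (forall x, (0 <= f x)%E) ->
  (\int[nu]_x f x = \int[mu]_x ((w x)%:E * f x))%E.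
Proof.
move=> mf f0; pose g := nnsfun_approx measurableT mf.
have ndg x : nondecreasing_seq (fun n => (g n x)%:E).
  by move=> m n mn; rewrite lee_fin; exact/lefP/nd_nnsfun_approx.
have mg n : measurable_fun setT (fun x => (g n x)%:E) by exact/measurable_EFinP.
have mwE : measurable_fun setT (fun x => (w x)%:E) by exact/measurable_EFinP.
transitivity (limn (fun n => \int[nu]_x (g n x)%:E))%E.
  rewrite -monotone_convergence//; last by move=> n x _; rewrite lee_fin.
  by apply: eq_integral => x _; apply/esym/cvg_lim => //; exact: cvg_nnsfun_approx.
transitivity (limn (fun n => \int[mu]_x ((w x)%:E * (g n x)%:E)))%E; last first.
  rewrite -monotone_convergence//; last 3 first.
  - by move=> n; exact: emeasurable_funM.
  - by move=> n x _; rewrite mule_ge0// lee_fin.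
  - by move=> x _ m n mn; rewrite lee_wpmul2l ?lee_fin//; exact: ndg.
  apply: eq_integral => x _; apply/cvg_lim => //.
  by apply: cvgeZl => //; exact: cvg_nnsfun_approx.
apply/congr_lim/funext => n.
under [LHS]eq_integral do rewrite fimfunE -fsumEFin//.
have mi r : measurable_fun setT (fun x => (r * \1_(g n @^-1` [set r]) x)%:E).
  by apply/measurable_EFinP; exact: measurable_funM.
rewrite ge0_integral_fsum//; last by move=> r x _; exact: nnfun_muleindic_ge0.
transitivity (\int[mu]_x (\sum_(y \in range (g n))
    ((w x)%:E * (y * \1_(g n @^-1` [set y]) x)%:E)))%E; last first.
  apply: eq_integral => x _; rewrite [in RHS]fimfunE -fsumEFin//.
  by rewrite ge0_mule_fsumr// => r; exact: nnfun_muleindic_ge0.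
rewrite ge0_integral_fsum//; last 2 first.
- by move=> r; exact: emeasurable_funM.
- by move=> r x _; rewrite mule_ge0 ?lee_fin//; exact: nnfun_muleindic_ge0.
apply: eq_fsbigr => r /[!inE] -[y _ <-]; set k := g n y.
under [LHS]eq_integral do rewrite EFinM.
rewrite integralZl_indic_nnsfun// integral_indic// setIT.
under eq_integral do rewrite EFinM muleCA.
rewrite ge0_integralZl//; last 3 first.
- by apply: emeasurable_funM => //; exact/measurable_EFinP.
- by move=> x _; rewrite mule_ge0// lee_fin.
- by rewrite lee_fin.
congr (_ * _)%E; rewrite /weighted [LHS]integral_mkcond.
by apply: eq_integral => x _; rewrite epatch_indic.
Qed.

End weighted_measure.

(** * Change of measure for one Gaussian increment *)
Section normal_tilt.
Context {R : realType}.
Local Notation mu := lebesgue_measure.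

Lemma lebesgue_measure_reflect (a : R) (A : set R) : measurable A ->
  pushforward mu (fun z => a - z : measurableTypeR R) A = mu A.
Proof.
have mr : measurable_fun setT (fun z : R => a - z).
  by apply: measurable_funB => //; exact: measurable_id.
move=> mA; pose m := pushforward mu (fun z : R => a - z : measurableTypeR R).
apply/esym/lebesgue_measure_unique => //= _ [[p q]] _ <-.
rewrite /pushforward (_ : _ @^-1` _ = `[a - q, a - p[%classic); last first.
  by apply/seteqP; split => z /=; rewrite !in_itv/= => /andP[? ?]; apply/andP; split; lra.
rewrite !lebesgue_measure_itv/= !lte_fin.
have -> : (a - q < a - p) = (p < q) by apply/idP/idP; lra.
by case: ifPn => // _; rewrite -!EFinB; congr EFin; lra.
Qed.

Lemma integral_reflect (a : R) (f : R -> \bar R) :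
  measurable_fun setT f -> (forall x, (0 <= f x)%E) ->
  (\int[mu]_z f (a - z)%R = \int[mu]_z f z)%E.
Proof.
move=> mf f0.
have mr : measurable_fun setT (fun z : measurableTypeR R => a - z : measurableTypeR R).
  by apply: measurable_funB => //; exact: measurable_id.
transitivity (\int[mu]_(z in (fun z : measurableTypeR R => (a - z)%R : measurableTypeR R)
    @^-1` setT) (f \o (fun z => (a - z)%R)) z)%E; first by rewrite preimage_setT.
rewrite -ge0_integral_pushforward//.
by apply: eq_measure_integral => //= A mA _; exact: lebesgue_measure_reflect.
Qed.

(** With step = z - c v, where z is centred with variance v, completing the
    square gives exp (2 c step) * pdf z = pdf (2 c v - z), and the reflection
    z |-> 2 c v - z exchanges step and - step.  The factor 2 c is the value for
    which the tilted drift is exactly opposite; it is the exponential rate of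
    the whole development. *)
Lemma normal_tilt (c v : R) (A : set R) : 0 < v -> measurable A ->
  (\int[normal_prob 0 (Num.sqrt v)]_z
     ((expR (2 * c * (z - c * v))%R)%:E * (\1_A (- (z - c * v))%R)%:E) =
   normal_prob 0%R (Num.sqrt v) [set z | A (z - c * v)%R])%E.
Proof.
move=> v0 mA; set s := Num.sqrt v.
have s0 : s != 0 by rewrite gt_eqF// sqrtr_gt0.
have s2 : s ^+ 2 = v by rewrite sqr_sqrtr// ltW.
have mp := @measurable_normal_pdf R 0 s.
have p0 x : 0 <= normal_pdf 0 s x by exact: normal_pdf_ge0.
have mB : measurable_fun setT (fun z : R => z - c * v).
  by apply: measurable_funB => //; exact: measurable_id.
have mA' : measurable_fun setT (fun z : R => \1_A (- (z - c * v)) : R).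
  apply: measurableT_comp => //; apply: measurableT_comp => //.
transitivity (\int[weighted mu mp p0]_z
     ((expR (2 * c * (z - c * v))%R)%:E * (\1_A (- (z - c * v))%R)%:E))%E.
  by [].
rewrite ge0_integral_weighted//; last first.
  apply: emeasurable_funM; apply/measurable_EFinP => //.
  by apply: measurableT_comp => //; apply: measurable_funM.
have mA2 : measurable [set z | A (z - c * v)].
  by rewrite -[X in measurable X]setTI; exact: mB.
rewrite /normal_prob [RHS]integral_mkcond.
rewrite -[RHS](integral_reflect (2 * c * v)); last 2 first.
- rewrite epatch_indic; apply: emeasurable_funM; apply/measurable_EFinP => //.
- by move=> x; rewrite epatch_indic mule_ge0// lee_fin.
apply: eq_integral => z _; rewrite epatch_indic -!EFinM; congr EFin.
have -> : \1_[set z | A (z - c * v)] (2 * c * v - z) = \1_A (- (z - c * v)) :> R.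
  by rewrite !indicE; congr (_ %:R); congr nat_of_bool; apply/idP/idP; rewrite !inE/= => h;
    [have -> : - (z - c * v) = 2 * c * v - z - c * v by lra|have -> : 2 * c * v - z - c * v = - (z - c * v) by lra].
rewrite mulrA; congr (_ * _); rewrite !normal_pdfE// -[LHS]mulrA; congr (_ * _).
rewrite /normal_fun -expRD; congr expR; rewrite s2; field.
by rewrite gt_eqF.
Qed.

End normal_tilt.


(** * Uniqueness of laws *)
Section law_uniqueness.
Context {d d' : measure_display} {T : measurableType d} {T' : measurableType d'}.
Context {R : realType} {U : Type}.
Variables (G : set (set U)) (mu : {measure set T -> \bar R})
  (nu : {measure set T' -> \bar R}) (X : T -> U) (Y : T' -> U).

Lemma measurable_preimage_sigma :
  (forall C, G C -> measurable (X @^-1` C)) ->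
  forall C, <<s G >> C -> measurable (X @^-1` C).
Proof.
move=> GX; apply: smallest_sub => //; split.
- by rewrite /= preimage_set0.
- by move=> A mA; rewrite /= setTD preimage_setC; exact: measurableC.
- by move=> F mF; rewrite /= preimage_bigcup; exact: bigcupT_measurable.
Qed.

Hypothesis GI : setI_closed G.
Hypothesis GX : forall C, G C -> measurable (X @^-1` C).
Hypothesis GY : forall C, G C -> measurable (Y @^-1` C).
Hypothesis muT : mu setT = nu setT.
Hypothesis mufin : (mu setT < +oo)%E.
Hypothesis munu : forall C, G C -> mu (X @^-1` C) = nu (Y @^-1` C).

(** Dynkin's theorem, stated for two measures on different sample spaces
    pulled back along X and Y, because the same generator serves to compare a
    measure with a reweighted one, with a restricted one, and with another
    process. *)
Lemma law_unique C : <<s G >> C -> mu (X @^-1` C) = nu (Y @^-1` C).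
Proof.
have mX := measurable_preimage_sigma GX.
have mY : forall C, <<s G >> C -> measurable (Y @^-1` C).
  apply: smallest_sub => //; split.
  - by rewrite /= preimage_set0.
  - by move=> A mA; rewrite /= setTD preimage_setC; exact: measurableC.
  - by move=> F mF; rewrite /= preimage_bigcup; exact: bigcupT_measurable.
suff : <<s G >> `<=` [set C | <<s G >> C /\ mu (X @^-1` C) = nu (Y @^-1` C)].
  by move=> /[apply] -[].
apply: lambda_system_subset => //.
- apply/dynkin_lambda_system; split => //=.
  + by split; [by rewrite -[X in <<s _ >> X](setD0 setT); apply: sigma_algebraCD; exact: sigma_algebra0|rewrite !preimage_setT].
  + move=> A [sA eA]; split; first by rewrite -setTD; exact: sigma_algebraCD.
    have XA := mX _ sA; have YA := mY _ sA.
    have nuoo : (nu setT < +oo)%E by rewrite -muT.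
    have -> : X @^-1` (~` A) = setT `\` X @^-1` A by rewrite setTD.
    have -> : Y @^-1` (~` A) = setT `\` Y @^-1` A by rewrite setTD.
    by rewrite measureD// measureD// !setTI; congr (_ - _)%E.
  + move=> F tF FG; split; first by apply: sigma_algebra_bigcup => i; have [] := FG i.
    rewrite !preimage_bigcup !measure_bigcup//.
    * by apply: eq_eseriesr => i _; have [] := FG i.
    * by move=> i _; apply: mY; have [] := FG i.
    * by apply/trivIsetP => i j _ _ ij; rewrite -preimage_setI; move/trivIsetP : tF => ->//; rewrite preimage_set0.
    * by move=> i _; apply: mX; have [] := FG i.
    * by apply/trivIsetP => i j _ _ ij; rewrite -preimage_setI; move/trivIsetP : tF => ->//; rewrite preimage_set0.
- by move=> A GA; split; [exact: sub_sigma_algebra|exact: munu].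
Qed.

End law_uniqueness.


Section rectangles.
Context {R : realType}.

(** Sequences are infinite but only their first n terms are constrained: the
    sigma-algebras of all grids live on one type, without casts between finite
    index types. *)
Definition rectangles (n : nat) : set (set (nat -> R)) :=
  [set C | exists2 A : nat -> set R, forall i, measurable (A i) &
     C = [set a | forall i, (i < n)%N -> A i (a i)]].

Lemma rectanglesI n : setI_closed (rectangles n).
Proof.
move=> _ _ [A mA ->] [B mB ->]; exists (fun i => A i `&` B i).
  by move=> i; exact: measurableI.
by apply/seteqP; split=> [a [aA aB] i ni|a aAB]; [split; [exact: aA|exact: aB]|
  split=> i /aAB[]].
Qed.

Lemma measurable_rectangle d (T : measurableType d) (n : nat)
    (xi : nat -> T -> R) (A : nat -> set R) :
  (forall i, measurable_fun setT (xi i)) -> (forall i, measurable (A i)) ->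
  measurable [set o | forall i, (i < n)%N -> A i (xi i o)].
Proof.
move=> mxi mA.
rewrite (_ : [set _ | _] = \bigcap_(i in `I_n) xi i @^-1` A i)//.
apply: fin_bigcap_measurable => // i _.
by rewrite -[X in measurable X]setTI; exact: mxi.
Qed.

Lemma grid_law_unique d (T : measurableType d) d' (T' : measurableType d')
    (mu : {measure set T -> \bar R}) (nu : {measure set T' -> \bar R})
    (n : nat) (xi : nat -> T -> R) (eta : nat -> T' -> R) :
  (forall i, measurable_fun setT (xi i)) ->
  (forall i, measurable_fun setT (eta i)) ->
  (mu setT < +oo)%E ->
  (forall A : nat -> set R, (forall i, measurable (A i)) ->
     mu [set o | forall i, (i < n)%N -> A i (xi i o)] =
     nu [set o | forall i, (i < n)%N -> A i (eta i o)]) ->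
  forall C, <<s rectangles n >> C ->
  mu [set o | C (xi ^~ o)] = nu [set o | C (eta ^~ o)].
Proof.
move=> mxi meta muoo munu C sC.
apply: (@law_unique _ _ _ _ _ _ (rectangles n) mu nu (fun o => xi ^~ o)
  (fun o => eta ^~ o)) => //.
- exact: rectanglesI.
- by move=> _ [A mA ->]; exact: measurable_rectangle.
- by move=> _ [A mA ->]; exact: measurable_rectangle.
- have := munu (fun=> setT) (fun=> measurableT).
  by rewrite (_ : [set _ | _] = setT)// (_ : [set _ | _] = setT)//; apply/seteqP; split.
- by move=> _ [A mA ->]; exact: munu.
Qed.

Lemma measurable_grid_event d (T : measurableType d) (n : nat)
    (xi : nat -> T -> R) C :
  (forall i, measurable_fun setT (xi i)) ->
  <<s rectangles n >> C -> measurable [set o | C (xi ^~ o)].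
Proof.
move=> mxi.
apply: (@measurable_preimage_sigma _ _ _ (rectangles n) (fun o => xi ^~ o)).
by move=> _ [A mA ->]; exact: measurable_rectangle.
Qed.

Lemma measurable_coordinate n i : (i < n)%N ->
  measurable_fun setT (fun a : g_sigma_algebraType (rectangles n) => a i).
Proof.
move=> ni _ B mB; rewrite setTI; apply: sub_sigma_algebra.
exists (fun j => if j == i then B else setT); first by move=> j; case: ifP.
apply/seteqP; split=> a /= aB.
  by move=> j jn; case: eqP => // ->.
by have := aB i ni; rewrite eqxx.
Qed.

Lemma measurable_partial_sum n k : (k <= n)%N ->
  measurable_fun setT
    (fun a : g_sigma_algebraType (rectangles n) => \sum_(i < k) a i).
Proof.
move=> kn; apply: measurable_sum => i.
by apply: measurable_coordinate; exact: leq_trans kn.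
Qed.

End rectangles.

Section expectation_of_product.
Context d (T : measurableType d) (R : realType) (P : probability T R).
Variables (n : nat) (xi : nat -> T -> R).
Hypothesis mxi : forall i, measurable_fun setT (xi i).
Hypothesis indep : forall A : nat -> set R, (forall i, measurable (A i)) ->
  P [set o | forall i, (i < n)%N -> A i (xi i o)] =
  (\prod_(i < n) P (xi i @^-1` A i))%E.

(** The indicators of the product rule are replaced by the functions f i one
    coordinate at a time.  When the other factors are frozen, both sides are
    measures of the set A k; these two measures agree, so they give f k the same
    integral. *)
Lemma integral_prod_independent (f : nat -> R -> R) :
  (forall i, measurable_fun setT (f i)) -> (forall i x, 0 <= f i x) ->
  (forall i, (\int[P]_o (f i (xi i o))%:E < +oo)%E) ->
  (\int[P]_o (\prod_(i < n) f i (xi i o))%:E =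
   \prod_(i < n) \int[P]_o (f i (xi i o))%:E)%E.
Proof.
move=> mf f0 fint.
pose F k (A : nat -> set R) i : R -> R := if (i < k)%N then f i else \1_(A i).
have mF k A i : (forall i, measurable (A i)) -> measurable_fun setT (F k A i).
  by move=> mA; rewrite /F; case: ifP.
have F0 k A i x : 0 <= F k A i x by rewrite /F; case: ifP.
have Fint k A i : (forall i, measurable (A i)) ->
    (\int[P]_o (F k A i (xi i o))%:E \is a fin_num)%E.
  move=> mA; rewrite ge0_fin_numE; last by apply: integral_ge0 => o _; rewrite lee_fin.
  rewrite /F; case: ifP => // _.
  apply: (@le_lt_trans _ _ (\int[P]_o 1)%E); last first.
    by rewrite integral_cst//= probability_setT mule1 ltry.
  apply: ge0_le_integral => //.
  - by apply/measurable_EFinP; apply: measurableT_comp.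
  - by move=> x _; rewrite lee_fin indicE; case: (_ \in _).
suff main k : (k <= n)%N -> forall A, (forall i, measurable (A i)) ->
   (\int[P]_o (\prod_(i < n) F k A i (xi i o))%:E =
    \prod_(i < n) \int[P]_o (F k A i (xi i o))%:E)%E.
  have := main n (leqnn n) (fun=> setT) (fun=> measurableT).
  rewrite (eq_integral (fun o => (\prod_(i < n) f i (xi i o))%:E)); last first.
    by move=> o _; congr EFin; apply: eq_bigr => i _; rewrite /F ltn_ord.
  by move=> ->; apply: eq_bigr => i _; rewrite /F ltn_ord.
elim: k => [_ A mA|k IH kn A mA].
  rewrite (eq_integral (fun o => (\1_[set o | forall i, (i < n)%N -> A i (xi i o)] o)%:E)).
    rewrite integral_indic//=; last exact: measurable_rectangle.
    rewrite setIT indep//; apply: eq_bigr => i _; rewrite /F /=.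
    rewrite (_ : (fun o => _) = (fun o => (\1_(xi i @^-1` A i) o)%:E))//.
    rewrite integral_indic//= ?setIT//.
    by rewrite -[X in measurable X]setTI; exact: mxi.
  move=> o _; congr EFin; rewrite /F /= [RHS]indicE.
  have [h|h] := pselect (forall i, (i < n)%N -> A i (xi i o)).
    rewrite mem_set// big1// => i _; rewrite indicE mem_set//; exact: h.
  rewrite memNset//.
  have [i iA] : exists i : 'I_n, ~ A i (xi i o).
    apply: contrapT => /forallNP h'; apply: h => i ni.
    by have /contrapT := h' (Ordinal ni).
  by rewrite (bigD1 i)//= indicE memNset// mul0r.
pose i0 := Ordinal kn.
(* the frozen factors: all coordinates but k *)
pose w o := \prod_(i < n | i != i0) F k.+1 A i (xi i o).
have mw : measurable_fun setT w.
  rewrite /w; under eq_fun do rewrite big_mkcond.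
  apply: measurable_prod => i _; case: (i != i0) => //.
  by apply: measurableT_comp => //; exact: mF.
have w0 o : 0 <= w o by apply: prodr_ge0 => i _; exact: F0.
pose K := (\prod_(i < n | i != i0) \int[P]_o (F k.+1 A i (xi i o))%:E)%E.
have K0 : (0 <= K)%E.
  by apply: prode_ge0 => i _; apply: integral_ge0 => o _; rewrite lee_fin.
have Kfin : K \is a fin_num.
  by apply: prode_fin_num => i _; exact: Fint.
pose Kn := NngNum (fine_ge0 K0).
have swap (A0 : set R) : measurable A0 ->
    (\int[P]_o ((w o)%:E * (\1_A0 (xi k o))%:E) = K * P (xi k @^-1` A0))%E.
  move=> mA0; pose A' i := if i == k then A0 else A i.
  have mA' i : measurable (A' i) by rewrite /A'; case: ifP.
  have FA' i : i != k -> F k A' i = F k.+1 A i.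
    move=> ik; by rewrite /F /A' (negbTE ik) ltnS [(i <= k)%N]leq_eqVlt (negbTE ik).
  have := IH (ltnW kn) A' mA'.
  rewrite (bigD1 i0)//= => IHk.
  transitivity (\int[P]_o (\prod_(i < n) F k A' i (xi i o))%:E)%E.
    apply: eq_integral => o _; rewrite -EFinM; congr EFin.
    rewrite (bigD1 i0)//= mulrC /F ltnn /A' eqxx; congr (_ * _).
    by apply: eq_bigr => i ii0; rewrite -FA'// /F /A'.
  rewrite IHk muleC; congr (_ * _)%E.
    by apply: eq_bigr => i ii0; rewrite -FA'.
  rewrite /F ltnn /A' eqxx.
  rewrite (_ : (fun o => _) = (fun o => (\1_(xi k @^-1` A0) o)%:E))//.
  rewrite integral_indic//= ?setIT//.
  by rewrite -[X in measurable X]setTI; exact: mxi.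
have mfk : measurable_fun setT (fun x => (f k x)%:E) by exact/measurable_EFinP.
transitivity (\int[P]_o ((w o)%:E * (f k (xi k o))%:E))%E.
  apply: eq_integral => o _; rewrite (bigD1 i0)//= -EFinM mulrC; congr EFin.
  by rewrite /F ltnSn.
rewrite (bigD1 i0)//= -/K {1}/F ltnSn muleC.
rewrite -(@ge0_integral_weighted _ _ _ P w mw w0 (fun o => (f k (xi k o))%:E)); last 2 first.
- by apply/measurable_EFinP; exact: measurableT_comp.
- by move=> x; rewrite lee_fin.
transitivity (\int[weighted P mw w0]_(o in xi k @^-1` setT) ((fun x => (f k x)%:E) \o xi k) o)%E.
  by rewrite preimage_setT.
rewrite -ge0_integral_pushforward//; last by move=> x _; rewrite lee_fin.
transitivity (K * \int[P]_(o in xi k @^-1` setT) ((fun x => (f k x)%:E) \o xi k) o)%E; last first.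
  by rewrite preimage_setT.
rewrite -ge0_integral_pushforward//; last by move=> x _; rewrite lee_fin.
rewrite -(fineK Kfin) -[fine K]/(Kn%:num) -ge0_integral_mscale//; last by move=> x _; rewrite lee_fin.
apply: eq_measure_integral => B mB _.
transitivity (K * P (xi k @^-1` B))%E; last by rewrite -[in LHS](fineK Kfin).
rewrite -swap//; transitivity (\int[P]_(x in xi k @^-1` B) (w x)%:E)%E => //.
by rewrite integral_mkcond; apply: eq_integral => o _; rewrite epatch_indic.
Qed.

End expectation_of_product.


(** * Increments of Brownian motion with drift *)
Section drifted_brownian_motion.
Context (R : realType) (d : measure_display) (T : measurableType d).
Context (P : probability T R) (B : R -> {RV P >-> R}) (c : R).
Hypothesis hB : two_sided_brownian_motion B.

Definition drifted (t : R) (o : T) : R := B t o - c * t.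
Local Notation X := drifted.

Lemma drifted0 o : X 0 o = 0.
Proof. by case: hB => B0 _ _ _; rewrite /drifted B0 mulr0 subr0. Qed.

Lemma continuous_drifted o : continuous (X ^~ o).
Proof.
case: hB => _ cB _ _ t; apply: cvgB; first exact: cB.
by apply: cvgM; [exact: cvg_cst|exact: cvg_id].
Qed.

Lemma measurable_drifted t : measurable_fun setT (X t).
Proof. by apply: measurable_funB => //; exact: measurable_cst. Qed.

Definition increment (t : nat -> R) (i : nat) (o : T) : R :=
  X (t i.+1) o - X (t i) o.

Lemma measurable_increment t i : measurable_fun setT (increment t i).
Proof. by apply: measurable_funB; exact: measurable_drifted. Qed.

Lemma sum_increment t n o : \sum_(i < n) increment t i o = X (t n) o - X (t 0%N) o.
Proof.
rewrite -(big_mkord xpredT (fun i => increment t i o)) /increment.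
by rewrite (telescope_sumr (fun i => X (t i) o)).
Qed.

Let drift_shift s t A : measurable A ->
  [set o | A (X t o - X s o)] =
  [set o | [set z | A (z - c * (t - s))] (B t o - B s o)].
Proof.
move=> mA; apply/seteqP; split => o /=; rewrite /drifted;
  by rewrite (_ : B t o - c * t - (B s o - c * s) = B t o - B s o - c * (t - s))//; ring.
Qed.

Let measurable_shift (A : set R) (a : R) : measurable A ->
  measurable [set z : R | A (z - a)].
Proof.
move=> mA; rewrite -[X in measurable X]setTI.
by apply: (measurable_funB (@measurable_id _ _ _) (@measurable_cst _ _ _ _ setT a)).
Qed.

Lemma increment_law s t (A : set R) : s < t -> measurable A ->
  P [set o | A (X t o - X s o)] =
  normal_prob 0 (Num.sqrt (t - s)) [set z | A (z - c * (t - s))].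
Proof.
move=> st mA; rewrite drift_shift//.
by case: hB => _ _ -> //; exact: measurable_shift.
Qed.

Lemma increment_independent (n : nat) (t : nat -> R) (A : nat -> set R) :
  (forall i, t i < t i.+1) -> (forall i, measurable (A i)) ->
  P [set o | forall i, (i < n)%N -> A i (increment t i o)] =
  (\prod_(i < n) P (increment t i @^-1` A i))%E.
Proof.
move=> ti mA; case: hB => _ _ _ indep.
have := indep n t (fun i => [set z | A i (z - c * (t i.+1 - t i))]) ti.
rewrite (_ : [set o | _] = [set o | forall i, (i < n)%N -> A i (increment t i o)]).
  move=> ->; last by move=> i; exact: measurable_shift.
  by apply: eq_bigr => i _; rewrite -drift_shift.
apply/seteqP; split => o /= h i ni; have := h i ni;
  by rewrite /increment /drifted (_ : B (t i.+1) o - c * t i.+1 - (B (t i) o - c * t i) =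
    B (t i.+1) o - B (t i) o - c * (t i.+1 - t i))//; ring.
Qed.

Lemma increment_tilt s t (A : set R) : s < t -> measurable A ->
  (\int[P]_o (expR (2 * c * (X t o - X s o)) *
      \1_A (- (X t o - X s o)))%R%:E)%E =
  P [set o | A (X t o - X s o)].
Proof.
move=> st mA; rewrite increment_law// -normal_tilt ?subr_gt0//.
pose dB (o : T) : R := B t o - B s o.
have mdB : measurable_fun setT (dB : T -> measurableTypeR R).
  by apply: measurable_funB => //; exact: measurable_funP.
pose h (z : R) := ((expR (2 * c * (z - c * (t - s))))%:E *
  (\1_A (- (z - c * (t - s))))%:E)%E.
have mh : measurable_fun setT h.
  have mz : measurable_fun setT (fun z : R => z - c * (t - s)).
    by apply: measurable_funB => //; exact: measurable_id.
  apply: emeasurable_funM; apply/measurable_EFinP.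
    by apply: measurableT_comp => //; exact: measurable_funM.
  by apply: measurableT_comp => //; exact: measurableT_comp.
have h0 z : (0 <= h z)%E by rewrite mule_ge0// lee_fin ?expR_ge0.
transitivity (\int[P]_(o in dB @^-1` setT) (h \o dB) o)%E.
  rewrite preimage_setT; apply: eq_integral => o _; rewrite /h /= -EFinM /drifted.
  by rewrite (_ : B t o - c * t - (B s o - c * s) = dB o - c * (t - s))// /dB; ring.
rewrite -(ge0_integral_pushforward mdB)//.
transitivity (\int[normal_prob 0%R (Num.sqrt (t - s))]_z h z)%E => //.
apply: eq_measure_integral => D mD _.
by case: hB => _ _ + _; apply.
Qed.

End drifted_brownian_motion.


Section grid_laws.
Context (R : realType) (d : measure_display) (T : measurableType d).
Context (P : probability T R) (B : R -> {RV P >-> R}) (c : R).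
Hypothesis hB : two_sided_brownian_motion B.
Local Notation X := (drifted B c).
Local Notation dX := (increment B c).

Definition girsanov_weight (t : R) (o : T) : R := expR (2 * c * X t o).

Lemma measurable_girsanov_weight t : measurable_fun setT (girsanov_weight t).
Proof.
by apply: measurableT_comp => //; apply: measurable_funM => //; exact: measurable_drifted.
Qed.

Lemma girsanov_weight_ge0 t o : 0 <= girsanov_weight t o.
Proof. exact: expR_ge0. Qed.

(** The weight exp (2 c X(t_n)) is the product of the weights of the
    increments, each of which is mirrored by [increment_tilt]. *)
Lemma grid_girsanov (t : nat -> R) n (C : set (nat -> R)) : t 0%N = 0 -> (forall i, t i < t i.+1) ->
  <<s rectangles n >> C ->
  (\int[P]_(o in [set o | C (fun i => (- dX t i o)%R)]) (girsanov_weight (t n) o)%:E)%E =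
  P [set o | C (dX t ^~ o)].
Proof.
move=> t0 ti sC.
pose mu := weighted P (measurable_girsanov_weight (t n)) (girsanov_weight_ge0 (t n)).
have mdX i : measurable_fun setT (dX t i) by exact: measurable_increment.
have rect (A : nat -> set R) : (forall i, measurable (A i)) ->
     mu [set o | forall i, (i < n)%N -> A i (- dX t i o)] =
     P [set o | forall i, (i < n)%N -> A i (dX t i o)].
  move=> mA; rewrite (increment_independent _ hB)//.
  pose f i (z : R) : R := expR (2 * c * z) * \1_(A i) (- z).
  have mf i : measurable_fun setT (f i).
    apply: measurable_funM; first by apply: measurableT_comp => //; exact: measurable_funM.
    by apply: measurableT_comp => //; exact: measurable_indic.
  have f0 i z : 0 <= f i z by rewrite mulr_ge0// expR_ge0.
  have If i : (\int[P]_o (f i (dX t i o))%:E = P (dX t i @^-1` A i))%E.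
    exact: increment_tilt.
  transitivity (\int[P]_o (\prod_(i < n) f i (dX t i o))%:E)%E; last first.
    rewrite integral_prod_independent//.
    - by apply: eq_bigr => i _; rewrite If.
    - by move=> A' mA'; rewrite (increment_independent _ hB).
    - move=> i; rewrite If (le_lt_trans (probability_le1 _ _)) ?ltry//.
      by rewrite -[X in measurable X]setTI; exact: mdX.
  rewrite /mu /weighted integral_mkcond; apply: eq_integral => o _.
  rewrite epatch_indic -EFinM big_split/= -expR_sum -mulr_sumr sum_increment.
  rewrite t0 (drifted0 c hB) subr0; congr (_ * _)%:E; rewrite indicE.
  have [h|h] := pselect (forall i, (i < n)%N -> A i (- dX t i o)).
    by rewrite mem_set// big1// => i _; rewrite indicE mem_set//; exact: h.
  rewrite memNset//.
  have [i iA] : exists i : 'I_n, ~ A i (- dX t i o).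
    apply: contrapT => /forallNP h'; apply: h => i ni.
    by have /contrapT := h' (Ordinal ni).
  by rewrite (bigD1 i)//= indicE memNset// mul0r.
apply: (@grid_law_unique _ _ _ _ _ mu P n (fun i o => - dX t i o) (dX t)) => //.
- by move=> i; exact: measurableT_comp.
- have := rect (fun=> setT) (fun=> measurableT).
  have -> : [set o | forall i, (i < n)%N -> (fun=> [set: R]) i (- dX t i o)] = setT.
    by apply/seteqP; split.
  move=> E; suff : (P setT < +oo)%E by rewrite -E.
  by rewrite probability_setT ltry.
Qed.

Lemma grid_stationary (a delta : R) n C : 0 < delta -> <<s rectangles n >> C ->
  P [set o | C (dX (fun i => a + delta * i%:R) ^~ o)] =
  P [set o | C (dX (fun i => delta * i%:R) ^~ o)].
Proof.
move=> d0 sC.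
have ti i : delta * i%:R < delta * i.+1%:R by rewrite ltr_pM2l// ltr_nat.
have tai i : a + delta * i%:R < a + delta * i.+1%:R by rewrite ltrD2l.
apply: (@grid_law_unique _ _ _ _ _ P P n) => //.
- by move=> i; exact: measurable_increment.
- by move=> i; exact: measurable_increment.
- by apply: (le_lt_trans (probability_le1 _ _)) => //; exact: ltry.
move=> A mA.
transitivity (\prod_(i < n) P (dX (fun i => (a + delta * i%:R)%R) i @^-1` A i))%E.
  exact: increment_independent.
transitivity (\prod_(i < n) P (dX (fun i => (delta * i%:R)%R) i @^-1` A i))%E; last first.
  by apply/esym; exact: increment_independent.
apply: eq_bigr => i _.
have Ea := increment_law c hB (tai i) (mA i).
rewrite (_ : a + delta * i.+1%:R - _ = delta * i.+1%:R - delta * i%:R) in Ea; last by ring.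
exact: etrans Ea (esym (increment_law c hB (ti i) (mA i))).
Qed.

(** The product rule on rectangles is extended to D for a fixed rectangle in
    the past, and then to C for a fixed D. *)
Lemma grid_independent (t : nat -> R) k n C D : (forall i, t i < t i.+1) ->
  <<s rectangles k >> C -> <<s rectangles n >> D ->
  P ([set o | C (dX t ^~ o)] `&` [set o | D (fun i => dX t (k + i)%N o)]) =
  (P [set o | C (dX t ^~ o)] * P [set o | D (fun i => dX t (k + i)%N o)])%E.
Proof.
move=> ti sC sD.
have mdX i : measurable_fun setT (dX t i) by exact: measurable_increment.
have mC C' : <<s rectangles k >> C' -> measurable [set o | C' (dX t ^~ o)].
  exact: measurable_grid_event.
have mD : measurable [set o | D (fun i => dX t (k + i)%N o)].
  by apply: (measurable_grid_event _ sD) => i; exact: mdX.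
have Pfin A : measurable A -> (P A < +oo)%E.
  by move=> mA; rewrite (le_lt_trans (probability_le1 _ _)) ?ltry.
have Pge0 A : 0 <= fine (P A) by apply: fine_ge0; exact: measure_ge0.
have PE A : measurable A -> (fine (P A))%:E = P A.
  by move=> mA; rewrite fineK// ge0_fin_numE//; exact: Pfin.
have rect (A : nat -> set R) : (forall i, measurable (A i)) ->
  P ([set o | forall i, (i < k)%N -> A i (dX t i o)] `&`
     [set o | D (fun i => dX t (k + i)%N o)]) =
  (P [set o | forall i, (i < k)%N -> A i (dX t i o)] *
   P [set o | D (fun i => dX t (k + i)%N o)])%E.
  move=> mA; set RA := [set o | forall i, _].
  have mRA : measurable RA by exact: measurable_rectangle.
  rewrite setIC -(PE _ mRA).
  apply: (@grid_law_unique _ _ _ _ _ (mrestr P mRA) (mscale (NngNum (Pge0 RA)) P) n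
    (fun i => dX t (k + i)%N) (fun i => dX t (k + i)%N)) => //.
  - exact: (Pfin _ (measurableI _ _ measurableT mRA)).
  - move=> A' mA'; rewrite -[LHS]/(P (_ `&` RA)) -[RHS]/((fine (P RA))%:E * P _)%E PE//.
    pose A2 i := if (i < k)%N then A i else A' (i - k)%N.
    have mA2 i : measurable (A2 i) by rewrite /A2; case: ifP.
    have A2r i : A2 (k + i)%N = A' i by rewrite /A2 ltnNge leq_addr/= addKn.
    have t2 i : t (k + i)%N < t (k + i.+1)%N by rewrite addnS.
    have dXk i o : dX t (k + i)%N o = dX (fun i => t (k + i)%N) i o.
      by rewrite /increment addnS.
    transitivity (P [set o | forall i, (i < k + n)%N -> A2 i (dX t i o)]).
      congr (P _); apply/seteqP; split => o /= => [[hA' hRA] i ikn|h].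
        rewrite /A2; case: ifPn => ik; first exact: hRA.
        rewrite -leqNgt in ik; have := hA' (i - k)%N; rewrite subnKC//; apply.
        by rewrite ltn_subLR.
      split=> i ni.
        have := h (k + i)%N; rewrite A2r; apply.
        by rewrite ltn_add2l.
      by have := h i; rewrite /A2 ni; apply; rewrite ltn_addr.
    rewrite (increment_independent _ hB)// big_split_ord/=; congr (_ * _)%E.
      rewrite /RA (increment_independent _ hB)//; apply: eq_bigr => i _.
      by rewrite /A2 ltn_ord.
    rewrite (_ : [set o | _] = [set o | forall i, (i < n)%N -> A' i (dX (fun i => t (k + i)%N) i o)]).
      rewrite (increment_independent _ hB)//; apply: eq_bigr => i _.
      by rewrite A2r; congr (P _); apply/seteqP; split => o /=; rewrite dXk.
    by apply/seteqP; split => o /= h i ni; have := h i ni; rewrite dXk.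
rewrite muleC -(PE _ mD).
apply: (@grid_law_unique _ _ _ _ _ (mrestr P mD)
  (mscale (NngNum (Pge0 [set o | D (fun i => dX t (k + i)%N o)])) P) k (dX t) (dX t)) => //.
- exact: (Pfin _ (measurableI _ _ measurableT mD)).
- move=> A mA; set S := [set o | forall i, (i < k)%N -> _].
  transitivity (P (S `&` [set o | D (fun i => dX t (k + i)%N o)])) => //.
  by rewrite rect// muleC -[in LHS](PE _ mD).
Qed.

End grid_laws.


Lemma sigma_setT (U : Type) (G : set (set U)) : <<s G >> setT.
Proof. by rewrite -[X in <<s _ >> X](setD0 setT); apply: sigma_algebraCD; exact: sigma_algebra0. Qed.

(** * Laws of paths *)
Section dyadic_paths.
Context {R : realType}.
Implicit Types (H : R) (f : R -> R).

Definition dyadic H (m i : nat) : R := H * (i%:R / 2 ^+ m).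

Lemma dyadic0 H m : dyadic H m 0 = 0.
Proof. by rewrite /dyadic mul0r mulr0. Qed.

Lemma dyadic_end H m : dyadic H m (2 ^ m) = H.
Proof. by rewrite /dyadic natrX divff ?mulr1// expf_neq0. Qed.

Lemma dyadic_refine H m k i : dyadic H m i = dyadic H (m + k) (i * 2 ^ k).
Proof.
rewrite /dyadic natrM natrX exprD; field.
by rewrite !expf_neq0.
Qed.

Lemma dyadicS H m i : dyadic H m i.+1 - dyadic H m i = H / 2 ^+ m.
Proof. by rewrite /dyadic -mulrBr -mulrBl -natrB// subSnn mul1r. Qed.

Lemma ltr_dyadic H m i : 0 < H -> dyadic H m i < dyadic H m i.+1.
Proof. by move=> H0; rewrite -subr_gt0 dyadicS divr_gt0// exprn_gt0. Qed.

Definition dyadic_increments H m f (i : nat) : R :=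
  f (dyadic H m i.+1) - f (dyadic H m i).

Lemma sum_dyadic_increments H m f n : f 0 = 0 ->
  \sum_(i < n) dyadic_increments H m f i = f (dyadic H m n).
Proof.
move=> f0; rewrite -(big_mkord xpredT (dyadic_increments H m f)).
by rewrite (telescope_sumr (fun i => f (dyadic H m i)))// dyadic0 f0 subr0.
Qed.

(** A cylinder constrains the path at finitely many times, all of them on one
    dyadic grid of [0, H].  Indexing the constraints by time rather than by the
    position in a grid makes intersections of cylinders of different levels
    immediate. *)
Definition cylinders H : set (set (R -> R)) :=
  [set C | exists m, exists2 A : R -> set R,
     (forall t, measurable (A t)) /\
     (forall t, ~ (exists2 i, (i <= 2 ^ m)%N & t = dyadic H m i) -> A t = setT) &
     C = [set f | forall t, A t (f t)]].

Lemma cylindersI H : setI_closed (cylinders H).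
Proof.
move=> _ _ [m [A [mA AT] ->]] [n [A' [mA' A'T] ->]].
exists (m + n)%N, (fun t => A t `&` A' t); first split=> [t|t nt].
- exact: measurableI.
- rewrite AT ?A'T ?setIT// => -[i im ti]; apply: nt.
    exists (i * 2 ^ m)%N; first by rewrite addnC expnD leq_mul2r im orbT.
    by rewrite addnC -dyadic_refine.
  exists (i * 2 ^ n)%N; first by rewrite expnD leq_mul2r im orbT.
  by rewrite -dyadic_refine.
- by apply/seteqP; split=> [f [h1 h2] t|f h]; [split; [exact: h1|exact: h2]|
    split => t; have [] := h t].
Qed.

Lemma cylinder_increments H C : cylinders H C ->
  exists m, exists2 D, <<s rectangles (2 ^ m) >> D &
    forall f, f 0 = 0 -> C f <-> D (dyadic_increments H m f).
Proof.
move=> [m [A [mA AT] ->]]; exists m.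
exists [set a : nat -> R | forall i, (i <= 2 ^ m)%N -> A (dyadic H m i) (\sum_(j < i) a j)].
  rewrite (_ : [set _ | _] = \bigcap_(i in `I_(2 ^ m).+1)
    ((fun a : nat -> R => \sum_(j < i) a j) @^-1` A (dyadic H m i))).
    have : @measurable _ (g_sigma_algebraType (@rectangles R (2 ^ m)))
      (\bigcap_(i in `I_(2 ^ m).+1)
      ((fun a : nat -> R => \sum_(j < i) a j) @^-1` A (dyadic H m i))).
      apply: fin_bigcap_measurable => // i /= im.
      by rewrite -[X in measurable X]setTI; exact: measurable_partial_sum.
    by [].
  by apply/seteqP; split.
move=> f f0; split=> /= h.
  by move=> i im; rewrite sum_dyadic_increments.
move=> t; have [[i im ->]|nt] := pselect (exists2 i, (i <= 2 ^ m)%N & t = dyadic H m i).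
  by rewrite -(sum_dyadic_increments _ _ _ f0); exact: h.
by rewrite AT.
Qed.

(** An event of the sigma-algebra of n coordinates ignores the others, although
    it is a set of infinite sequences. *)
Lemma grid_event_ext n (C : set (nat -> R)) (a b : nat -> R) :
  <<s rectangles n >> C -> (forall i, (i < n)%N -> a i = b i) -> C a <-> C b.
Proof.
move=> sC ab.
suff : <<s rectangles n >> `<=` [set C | C a <-> C b] by apply.
apply: smallest_sub.
  split.
  - by [].
  - by move=> A /= Aab; split=> -[_ nA]; split=> // ?; apply: nA; apply/Aab.
  - by move=> F /= Fab; split=> -[k _ Fk]; exists k => //; apply/Fab.
move=> _ [A mA ->] /=.
by split=> h i ni; have := h i ni; rewrite ab.
Qed.

Lemma measurable_dyadic_coordinate H m i : (i <= 2 ^ m)%N ->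
  measurable_fun setT (fun f : g_sigma_algebraType (cylinders H) => f (dyadic H m i)).
Proof.
move=> im _ D mD; rewrite setTI; apply: sub_sigma_algebra.
exists m; exists (fun t => if t == dyadic H m i then D else setT).
  split=> [t|t nt]; first by case: ifP.
  by case: eqP => // ti; exfalso; apply: nt; exists i.
apply/seteqP; split=> f /= h.
  by move=> t; case: eqP => // ->.
by have := h (dyadic H m i); rewrite eqxx.
Qed.

(** Both processes start at 0, so that on each grid the positions are functions
    of the increments. *)
Lemma path_law_unique H d (T : measurableType d) d' (T' : measurableType d')
    (mu : {measure set T -> \bar R}) (nu : {measure set T' -> \bar R})
    (X : R -> T -> R) (Y : R -> T' -> R) :
  (forall t, measurable_fun setT (X t)) -> (forall t, measurable_fun setT (Y t)) ->
  (forall o, X 0 o = 0) -> (forall o, Y 0 o = 0) ->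
  (mu setT < +oo)%E ->
  (forall m D, <<s rectangles (2 ^ m) >> D ->
     mu [set o | D (dyadic_increments H m (X ^~ o))] =
     nu [set o | D (dyadic_increments H m (Y ^~ o))]) ->
  forall C, <<s cylinders H >> C ->
  mu [set o | C (X ^~ o)] = nu [set o | C (Y ^~ o)].
Proof.
move=> mX mY X0 Y0 muoo munu C sC.
have E (C' : set (R -> R)) : cylinders H C' -> exists m, exists2 D,
    <<s rectangles (2 ^ m) >> D &
    [set o | C' (X ^~ o)] = [set o | D (dyadic_increments H m (X ^~ o))] /\
    [set o | C' (Y ^~ o)] = [set o | D (dyadic_increments H m (Y ^~ o))].
  move=> /cylinder_increments[m [D sD CD]]; exists m; exists D => //.
  split; apply/seteqP; split=> o /=.
  - by move/(CD _ (X0 o)).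
  - by move=> ?; apply/(CD _ (X0 o)).
  - by move/(CD _ (Y0 o)).
  - by move=> ?; apply/(CD _ (Y0 o)).
apply: (@law_unique _ _ _ _ _ _ (cylinders H) mu nu (fun o => X ^~ o)
  (fun o => Y ^~ o)) => //.
- exact: cylindersI.
- move=> C' /E[m [D sD [XE _]]]; rewrite [X in measurable X]XE.
  apply: (measurable_grid_event _ sD) => i; exact: measurable_funB.
- move=> C' /E[m [D sD [_ YE]]]; rewrite [X in measurable X]YE.
  apply: (measurable_grid_event _ sD) => i; exact: measurable_funB.
- exact: (munu 0%N setT (sigma_setT _)).
- move=> C' /E[m [D sD [XE YE]]].
  rewrite [X in mu X = _]XE [X in _ = nu X]YE; exact: munu.
Qed.

End dyadic_paths.

Section path_laws.
Context (R : realType) (d : measure_display) (T : measurableType d).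
Context (P : probability T R) (B : R -> {RV P >-> R}) (c H : R).
Hypotheses (hB : two_sided_brownian_motion B) (H0 : 0 < H).
Local Notation X := (drifted B c).

(** The Cameron-Martin change of measure between the drifts -c and c, combined
    with the symmetry of Brownian motion. *)
Theorem path_girsanov (C : set (R -> R)) : <<s cylinders H >> C ->
  (\int[P]_(o in [set o | C (fun t => (- X t o)%R)]) (girsanov_weight B c H o)%:E)%E =
  P [set o | C (X ^~ o)].
Proof.
pose mu := weighted P (measurable_girsanov_weight B c H) (girsanov_weight_ge0 B c H).
have incr m (D : set (nat -> R)) : <<s rectangles (2 ^ m) >> D ->
    mu [set o | D (dyadic_increments H m (fun t => - X t o))] =
    P [set o | D (dyadic_increments H m (X ^~ o))].
  move=> sD.
  rewrite -(grid_girsanov c hB (dyadic0 H m) (fun i => ltr_dyadic m i H0) sD).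
  rewrite dyadic_end /mu /weighted /=; congr (integral _ _ _).
  apply/seteqP; split => o /=;
    rewrite (_ : dyadic_increments _ _ _ = (fun i => - increment B c (dyadic H m) i o))//;
    by apply/funext => i; rewrite /dyadic_increments /increment; ring.
move=> sC; apply: (@path_law_unique _ H _ _ _ _ mu P (fun t o => - X t o) X) => //.
- by move=> t; apply: measurableT_comp => //; exact: measurable_drifted.
- by move=> t; exact: measurable_drifted.
- by move=> o; rewrite (drifted0 c hB) oppr0.
- by move=> o; rewrite (drifted0 c hB).
have E : mu setT = P setT by exact: (incr 0%N setT (sigma_setT _)).
suff : (P setT < +oo)%E by rewrite -E.
by rewrite probability_setT ltry.
Qed.

Lemma path_future_independent (delta : R) n (C : set (R -> R)) (D : set (nat -> R)) :
  0 < delta -> <<s cylinders H >> C -> <<s rectangles n >> D ->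
  P ([set o | C (X ^~ o)] `&`
     [set o | D (increment B c (fun i => H + delta * i%:R) ^~ o)]) =
  (P [set o | C (X ^~ o)] *
   P [set o | D (increment B c (fun i => (H + delta * i%:R)%R) ^~ o)])%E.
Proof.
move=> d0 sC sD; set F := [set o | D _].
have mF : measurable F.
  by apply: (measurable_grid_event _ sD) => i; exact: measurable_increment.
have PF : (fine (P F))%:E = P F.
  rewrite fineK// ge0_fin_numE//.
  by rewrite (le_lt_trans (probability_le1 _ _)) ?ltry.
have Pge0 : 0 <= fine (P F) by apply: fine_ge0; exact: measure_ge0.
rewrite muleC -PF.
apply: (@path_law_unique _ H _ _ _ _ (mrestr P mF) (mscale (NngNum Pge0) P) X X) => //.
- by move=> t; exact: measurable_drifted.
- by move=> t; exact: measurable_drifted.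
- by move=> o; rewrite (drifted0 c hB).
- by move=> o; rewrite (drifted0 c hB).
- rewrite (le_lt_trans (probability_le1 P (measurableI _ _ measurableT mF)))//.
  exact: ltry.
move=> m D' sD'.
(* a single increasing grid: dyadic of level m up to H, of mesh delta after H *)
pose t i := if (i <= 2 ^ m)%N then dyadic H m i else H + delta * (i - 2 ^ m)%:R.
have tpast i : (i <= 2 ^ m)%N -> t i = dyadic H m i by rewrite /t => ->.
have tfuture i : t (2 ^ m + i)%N = H + delta * i%:R.
  rewrite /t; case: ifPn => [|_]; last by rewrite addKn.
  rewrite -[X in (_ <= X)%N]addn0 leq_add2l leqn0 => /eqP ->.
  by rewrite addn0 dyadic_end mulr0 addr0.
have ti i : t i < t i.+1.
  case: (ltnP i (2 ^ m)) => im.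
    by rewrite !tpast ?(ltnW im)//; exact: ltr_dyadic.
  by rewrite -(subnKC im) -addnS !tfuture ltrD2l ltr_pM2l// ltr_nat.
have E o : D' (dyadic_increments H m (X ^~ o)) <-> D' (increment B c t ^~ o).
  apply: (grid_event_ext sD') => i im.
  by rewrite /dyadic_increments /increment !tpast// ltnW.
have F' : F = [set o | D (fun i => increment B c t (2 ^ m + i)%N o)].
  by apply/seteqP; split => o; rewrite /F /=;
    rewrite (_ : (fun i => increment B c t _ o) =
      increment B c (fun i => H + delta * i%:R) ^~ o)//;
    apply/funext => i; rewrite /increment -addnS !tfuture.
have D'E : [set o | D' (dyadic_increments H m (X ^~ o))] =
    [set o | D' (increment B c t ^~ o)].
  by apply/seteqP; split => o /= /E.
transitivity (P ([set o | D' (dyadic_increments H m (X ^~ o))] `&` F)) => //.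
transitivity (P F * P [set o | D' (dyadic_increments H m (X ^~ o))])%E.
  by rewrite muleC F' D'E; exact: (grid_independent c hB ti sD' sD).
by rewrite -[in LHS]PF.
Qed.

End path_laws.


(** * Occupation times as countable path events *)
Section long_occupation.
Context {R : realType}.
Implicit Types (H x y t : R) (f : R -> \bar R).
Local Notation mu := lebesgue_measure.

(** A description of the event that f spends more than x time units of [T1, H]
    above y, which involves f at dyadic times only: some level has enough cells
    on which f is above y.  The margin 1 / (j + 1) makes the condition at
    dyadic points imply the strict inequality on the whole cell by continuity,
    and it makes the set of admissible y open. *)
Definition long_occupation T1 H x y f : Prop :=
  exists m j (I : {set 'I_(2 ^ m)}), x < #|I|%:R * (H / 2 ^+ m) /\
    forall i, i \in I -> T1 <= dyadic H m i /\
      forall n k, dyadic H m i <= dyadic H n k <= dyadic H m i.+1 ->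
        ((y + j.+1%:R^-1)%:E <= f (dyadic H n k))%E.

Lemma dyadic_floor H m t : 0 < H -> 0 <= t ->
  exists k, dyadic H m k <= t < dyadic H m k.+1.
Proof.
move=> H0 t0; have p0 : 0 < 2 ^+ m :> R by rewrite exprn_gt0.
have h0 : 0 <= t / H * 2 ^+ m by rewrite mulr_ge0 ?divr_ge0// ltW.
exists (Num.truncn (t / H * 2 ^+ m)); have /andP[h1 h2] := truncn_itv h0.
have tE : t = H * (t / H * 2 ^+ m / 2 ^+ m) by rewrite mulfK ?gt_eqF// mulrC divfK ?gt_eqF.
rewrite /dyadic; apply/andP; split.
  by rewrite [leRHS]tE ler_pM2l// ler_pM2r ?invr_gt0.
by rewrite [ltLHS]tE ltr_pM2l// ltr_pM2r ?invr_gt0.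
Qed.

Lemma ler_dyadic H m i j : 0 < H -> (dyadic H m i <= dyadic H m j) = (i <= j)%N.
Proof.
by move=> H0; rewrite /dyadic ler_pM2l// ler_pM2r ?ler_nat// invr_gt0 exprn_gt0.
Qed.

Lemma ltr_dyadic_mono H m i j : 0 < H -> (dyadic H m i < dyadic H m j) = (i < j)%N.
Proof.
by move=> H0; rewrite /dyadic ltr_pM2l// ltr_pM2r ?ltr_nat// invr_gt0 exprn_gt0.
Qed.

Lemma dyadic_mesh H e : 0 < e -> exists m0, forall m, (m0 <= m)%N -> H / 2 ^+ m < e.
Proof.
move=> e0; have [m0 hm0] : exists m0 : nat, H / e < m0%:R.
  by exists (Num.truncn (H / e)).+1; exact: truncnS_gt.
exists m0 => m m0m; rewrite ltr_pdivrMr ?exprn_gt0// mulrC -ltr_pdivrMr//.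
rewrite (lt_le_trans hm0)// -natrX ler_nat (leq_trans m0m)//.
by rewrite ltnW// ltn_expl.
Qed.

Lemma dyadic_cell_dense H m i t e : 0 < H -> 0 < e ->
  dyadic H m i <= t < dyadic H m i.+1 ->
  exists n k, dyadic H m i <= dyadic H n k <= dyadic H m i.+1 /\
    `|t - dyadic H n k| < e.
Proof.
move=> H0 e0 /andP[it ti].
have [p0 hp0] := dyadic_mesh H e0.
have t0 : 0 <= t.
  by apply: le_trans it; rewrite -(dyadic0 H m) ler_dyadic.
have [k /andP[kt tk]] := dyadic_floor (m + p0) H0 t0.
exists (m + p0)%N, k; split.
  rewrite (le_trans kt (ltW ti)) andbT.
  rewrite (dyadic_refine H m p0 i) ler_dyadic// -ltnS -(ltr_dyadic_mono (m + p0) _ _ H0).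
  by rewrite -dyadic_refine (le_lt_trans it).
rewrite ger0_norm ?subr_ge0//; apply: lt_trans (hp0 _ (leq_addl m p0)).
by rewrite -(dyadicS H _ k) ltrD2r.
Qed.

Lemma measure_dyadic_cells H m (I : {set 'I_(2 ^ m)}) : 0 < H ->
  mu (\big[setU/set0]_(i < 2 ^ m | i \in I) `[dyadic H m i, dyadic H m i.+1[%classic) =
  (#|I|%:R * (H / 2 ^+ m))%:E.
Proof.
move=> H0; rewrite big_mkcond/= measure_semi_additive_ord//.
- rewrite (eq_bigr (fun i => (if i \in I then H / 2 ^+ m else 0)%:E)) => [|i _].
    by rewrite sumEFin -big_mkcond/= sumr_const mulr_natl.
  case: ifP => _; last by rewrite measure0.
  by rewrite /= lebesgue_measure_itv/= lte_fin ltr_dyadic// -EFinD dyadicS.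
- by move=> k; case: ifP.
- apply/trivIsetP => i j _ _ ij; apply/seteqP; split=> // t /=.
  case: ifP => // _ [ti]; case: ifP => // _ tj.
  move: ti tj; rewrite /= !in_itv/= => /andP[it ti] /andP[jt tj].
  have := le_lt_trans it tj; rewrite ltr_dyadic_mono// ltnS => ij1.
  have := le_lt_trans jt ti; rewrite ltr_dyadic_mono// ltnS => ij2.
  by move/eqP : ij; apply; apply/val_inj/eqP; rewrite eqn_leq ij1.
- by apply: bigsetU_measurable => k _; case: ifP.
Qed.

Lemma within_continuous_open (D : set R) f (S : set (\bar R)) :
  {within D, continuous f} -> open S ->
  exists2 V : set R, open V & forall t, D t -> V t <-> S (f t).
Proof.
move=> /continuousP cf oS; have /open_subspaceP[V oV VE] := cf _ oS.
exists V => // t Dt; split => h.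
  by have : (V `&` D) t by []; rewrite VE => -[].
by have : (f @^-1` S `&` D) t by []; rewrite -VE => -[].
Qed.

Lemma occupation_timeE (T1 T2 y : R) f : {within `[T1, T2], continuous f} ->
  measurable ([set t | (y%:E < f t)%E] `&` `[T1, T2]) /\
  occupation_time T1 T2 f y = mu ([set t | (y%:E < f t)%E] `&` `[T1, T2]).
Proof.
move=> cf; set S := [set t | (y%:E < f t)%E].
have mS : measurable (S `&` `[T1, T2]).
  have [V oV VE] := within_continuous_open cf (@open_ereal_gt_ereal _ y%:E).
  rewrite (_ : _ `&` _ = V `&` `[T1, T2]).
    by apply: measurableI => //; exact: open_measurable.
  by apply/seteqP; split => t [h Dt]; split => //; apply/VE.
split=> //; rewrite /occupation_time.
transitivity (\int[mu]_(t in `[T1, T2]) (\1_(S `&` `[T1, T2]) t)%:E)%E.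
  apply: eq_integral => t tD; rewrite !indicE; congr (_%:R%:E).
  by rewrite in_setI tD andbT.
by rewrite integral_indic// -setIA setIid.
Qed.

(** The cells of level m on which f exceeds y with some margin are disjoint and
    grow with m.  By continuity they exhaust the relatively open set where
    f > y, up to the two end points, so that the measure of this set exceeds x
    if and only if the total length of the cells of some level does. *)
Lemma long_occupationP T1 H x y f : 0 <= T1 < H ->
  {within `[T1, H], continuous f} ->
  long_occupation T1 H x y f <-> (x%:E < occupation_time T1 H f y)%E.
Proof.
move=> /andP[T10 T1H] cf; have H0 : 0 < H by exact: le_lt_trans T1H.
have [mO ->] := occupation_timeE y cf.
set O := _ `&` _ in mO *; split.
  move=> [m [j [I [xI hI]]]].
  apply: (@lt_le_trans _ _ (#|I|%:R * (H / 2 ^+ m))%:E); first by rewrite lte_fin.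
  rewrite -measure_dyadic_cells//; apply: le_measure; rewrite ?inE//.
    by apply: bigsetU_measurable.
  move=> t; rewrite -bigcup_seq_cond /= => -[i /andP[_ iI] /=]; rewrite in_itv/= => itv.
  have /andP[it ti] := itv.
  have [T1i hi] := hI i iI.
  have Dt : `[T1, H]%classic t.
    rewrite /= in_itv/= (le_trans T1i)//= (le_trans (ltW ti))//.
    by rewrite -[leRHS](dyadic_end H m) ler_dyadic.
  split=> //=; rewrite ltNge; apply/negP => fty.
  pose z := y + j.+1%:R^-1.
  have ftz : (f t < z%:E)%E.
    by rewrite (le_lt_trans fty)// lte_fin ltrDl invr_gt0.
  have [V oV VE] := within_continuous_open cf (@open_ereal_lt_ereal _ z%:E).
  have /(VE _ Dt) Vt := ftz.
  have /nbhs_ballP[e /= e0 teV] := open_nbhs_nbhs (conj oV Vt).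
  have [n [k [nk tnk]]] := dyadic_cell_dense H0 e0 itv.
  have := hi n k nk; rewrite leNgt => /negP; apply.
  apply/VE; last by apply: teV.
  move/andP: nk => [n1 n2]; rewrite /= in_itv/= (le_trans T1i)//=.
  by rewrite (le_trans n2)// -[leRHS](dyadic_end H m) ler_dyadic.
move=> xO.
pose cell m i : set R := `[dyadic H m i, dyadic H m i.+1[%classic.
pose good m i := T1 <= dyadic H m i /\ exists j, forall n k,
  dyadic H m i <= dyadic H n k <= dyadic H m i.+1 ->
  ((y + (j : nat).+1%:R^-1)%:E <= f (dyadic H n k))%E.
pose J m := finset (fun i : 'I_(2 ^ m) => `[< good m i >]).
pose U m := \big[setU/set0]_(i < 2 ^ m | i \in J m) cell m i.
have UE m t : U m t <-> exists i, (i < 2 ^ m)%N /\ good m i /\ dyadic H m i <= t < dyadic H m i.+1.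
  rewrite /U -bigcup_seq_cond /=; split.
    move=> [i /andP[_ iJ]]; rewrite /cell /= in_itv/= => it; exists i; split => //.
    by split => //; move: iJ; rewrite inE => /asboolP.
  move=> [i [im [gi it]]]; exists (Ordinal im) => /=; last by rewrite /cell/= in_itv.
  by rewrite mem_index_enum/= inE; exact/asboolP.
have mU m : measurable (U m) by apply: bigsetU_measurable => i _; exact: measurable_itv.
have ndU : nondecreasing_seq U.
  apply/nondecreasing_seqP => m; apply/subsetPset => t /UE[i [im [[T1i [j gj]] /andP[it ti]]]].
  apply/UE.
  have t0 : 0 <= t by apply: le_trans it; rewrite (le_trans T10).
  have [k /andP[kt tk]] := dyadic_floor m.+1 H0 t0.
  have dk : dyadic H m i <= dyadic H m.+1 k.
    rewrite (dyadic_refine H m 1 i) addn1 ler_dyadic// -ltnS -(ltr_dyadic_mono m.+1 _ _ H0).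
    by rewrite -addn1 -dyadic_refine (le_lt_trans it) ?addn1.
  have kd : dyadic H m.+1 k.+1 <= dyadic H m i.+1.
    rewrite (dyadic_refine H m 1 i.+1) addn1 ler_dyadic// -(ltr_dyadic_mono m.+1 _ _ H0).
    by rewrite -[m.+1 in ltRHS]addn1 -dyadic_refine (le_lt_trans kt).
  exists k; split.
    rewrite -(ltr_dyadic_mono m.+1 _ _ H0) dyadic_end (le_lt_trans kt)//.
    by rewrite (lt_le_trans ti)// -[leRHS](dyadic_end H m) ler_dyadic.
  split; last by rewrite kt.
  split; first exact: le_trans dk.
  exists j => n l /andP[h1 h2]; apply: gj.
  by rewrite (le_trans dk)//= (le_trans h2).
have OU : O `<=` \bigcup_m U m `|` ([set T1] `|` [set H]).
  move=> t [/= yt]; rewrite in_itv/= => /andP[T1t tH].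
  have [->|tT1] := eqVneq t T1; first by right; left.
  have [->|tnH] := eqVneq t H; first by right; right.
  left.
  have {T1t tT1}T1t : T1 < t by rewrite lt_neqAle eq_sym tT1.
  have {tH tnH}tH : t < H by rewrite lt_neqAle tnH.
  have Dt : `[T1, H]%classic t by rewrite /= in_itv/= !ltW.
  have [z yz zt] : exists2 z, y < z & (z%:E < f t)%E.
    move: yt; case: (f t) => [r| |//].
      by rewrite lte_fin => yr; exists ((y + r) / 2); rewrite ?lte_fin ?midf_lt.
    by move=> _; exists (y + 1); [rewrite ltrDl|rewrite ltry].
  have [V oV VE] := within_continuous_open cf (@open_ereal_gt_ereal _ z%:E).
  have /(VE _ Dt) Vt := zt.
  have /nbhs_ballP[e /= e0 teV] := open_nbhs_nbhs (conj oV Vt).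
  have e'0 : 0 < Num.min e (Num.min (t - T1) (H - t)).
    by rewrite !lt_min e0 !subr_gt0 T1t.
  have [m hm] := dyadic_mesh H e'0.
  have := hm m (leqnn m); rewrite !lt_min => /and3P[he hT1 hH].
  have t0 : 0 <= t by rewrite (le_trans T10)// ltW.
  have [k /andP[kt tk]] := dyadic_floor m H0 t0.
  have ds := dyadicS H m k.
  have kH : dyadic H m k.+1 <= H by lra.
  have T1k : T1 <= dyadic H m k by lra.
  exists m => //; apply/UE; exists k; split.
    by rewrite -(ler_dyadic m _ _ H0) dyadic_end.
  split; last by rewrite kt.
  split=> //.
  exists (Num.truncn (z - y)^-1) => n l /andP[h1 h2].
  have zl : (z%:E < f (dyadic H n l))%E.
    apply/VE; first by rewrite /= in_itv/=; apply/andP; split; lra.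
    apply: teV; rewrite /ball/= ltr_norml; apply/andP; split; lra.
  apply: le_trans (ltW zl); rewrite lee_fin -lerBrDl.
  rewrite invf_ple ?posrE// ?subr_gt0// ltW//.
  exact: truncnS_gt.
have xU : (x%:E < mu (\bigcup_m U m))%E.
  apply: lt_le_trans xO _.
  have mUU : measurable (\bigcup_m U m) by exact: bigcupT_measurable.
  have m2 : measurable ([set T1] `|` [set H]) by apply: measurableU.
  have m0 : mu ([set T1] `|` [set H]) = 0%E.
    by rewrite measureU0; [exact: lebesgue_measure_set1|exact: measurable_set1|exact: measurable_set1|exact: lebesgue_measure_set1].
  apply: (@le_trans _ _ (mu (\bigcup_m U m `|` ([set T1] `|` [set H])))).
    by apply: le_measure; rewrite ?inE//; exact: measurableU.
  by rewrite measureU0.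
have [m xm] : exists m, (x%:E < mu (U m))%E.
  apply: contrapT => /forallNP nx.
  have cU : (mu \o U) m @[m --> \oo] --> mu (\bigcup_m U m).
    by apply: nondecreasing_cvg_mu => //; exact: bigcupT_measurable.
  have : (mu (\bigcup_n U n) <= x%:E)%E.
    apply: (cvge_le _ cU); apply: nearW => m /=.
    by rewrite leNgt; apply/negP => /nx.
  by rewrite leNgt xU.
(* one margin that serves all the cells of level m *)
pose jf (i : 'I_(2 ^ m)) := if pselect (good m i) is left p then sval (cid p.2) else 0%N.
exists m, (\max_(i < 2 ^ m) jf i)%N, (J m); split.
  by rewrite -lte_fin -measure_dyadic_cells.
move=> i; rewrite inE => /asboolP gi.
have := gi.1; split => // n k nk.
have hj : forall n k, dyadic H m i <= dyadic H n k <= dyadic H m i.+1 ->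
    ((y + (jf i).+1%:R^-1)%:E <= f (dyadic H n k))%E.
  by rewrite /jf; case: pselect => // p; case: cid.
apply: le_trans (hj n k nk); rewrite lee_fin lerD2l lef_pV2 ?posrE//.
by rewrite ler_nat ltnS leq_bigmax.
Qed.

End long_occupation.


Section long_occupation_theory.
Context {R : realType}.
Implicit Types (H x y t : R) (f g : R -> \bar R).

Lemma dyadic_in_cell H m n i k : 0 < H -> (i < 2 ^ m)%N ->
  dyadic H n k <= dyadic H m i.+1 -> (k <= 2 ^ n)%N.
Proof.
move=> H0 im h; rewrite -(ler_dyadic n _ _ H0) (le_trans h)//.
by rewrite dyadic_end -[leRHS](dyadic_end H m) ler_dyadic.
Qed.

Lemma measurable_long_occupation d (U : measurableType d) (e : R -> U -> \bar R)
    T1 H x y : 0 < H ->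
  (forall m i, (i <= 2 ^ m)%N -> measurable_fun setT (e (dyadic H m i))) ->
  measurable [set u | long_occupation T1 H x y (e ^~ u)].
Proof.
move=> H0 me.
pose K m j (I : {set 'I_(2 ^ m)}) : set U := if x < #|I|%:R * (H / 2 ^+ m) then
  \bigcap_(i in [set` I]) (if T1 <= dyadic H m i then
     \bigcap_n \bigcap_k (if dyadic H m i <= dyadic H n k <= dyadic H m i.+1 then
        [set u | ((y + j.+1%:R^-1)%:E <= e (dyadic H n k) u)%E] else setT)
     else set0) else set0.
rewrite (_ : [set u | _] = \bigcup_m \bigcup_j \bigcup_(I in [set: {set 'I_(2 ^ m)}]) K m j I).
  apply: bigcupT_measurable => m; apply: bigcupT_measurable => j.
  apply: fin_bigcup_measurable => // I _; rewrite /K; case: ifP => // _.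
  apply: fin_bigcap_measurable => // i _; case: ifP => // _.
  apply: bigcapT_measurable => n; apply: bigcapT_measurable => k.
  case: ifPn => // /andP[_ h].
  have mek := me n k (dyadic_in_cell H0 (ltn_ord i) h).
  by rewrite -[X in measurable X]setTI; apply: emeasurable_fun_c_infty.
apply/seteqP; split=> u.
  move=> [m [j [I [xI hI]]]]; exists m => //; exists j => //; exists I => //.
  rewrite /K xI => i /= iI; have [-> hi] := hI i iI.
  by move=> n _ k _; case: ifPn => // h; exact: hi.
move=> [m _ [j _ [I _]]]; rewrite /K; case: ifPn => // xI h.
exists m, j, I; split=> // i iI; have := h i iI; case: ifPn => // T1i h'.
by split=> // n k nk; have := h' n Logic.I k Logic.I; rewrite nk.
Qed.

Lemma long_occupation_ext T1 H x y f g : 0 < H ->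
  (forall t, 0 <= t <= H -> f t = g t) ->
  long_occupation T1 H x y f -> long_occupation T1 H x y g.
Proof.
move=> H0 fg [m [j [I [xI hI]]]]; exists m, j, I; split=> // i iI.
have [T1i hi] := hI i iI; split=> // n k nk; rewrite -fg; first exact: hi.
move/andP : nk => [_ h]; have k2 := dyadic_in_cell H0 (ltn_ord i) h.
rewrite -{1}(dyadic0 H n) ler_dyadic// leq0n/=.
by rewrite -[leRHS](dyadic_end H n) ler_dyadic.
Qed.

Lemma long_occupation_shift T1 H x y v (g : R -> R) :
  long_occupation T1 H x y (fun t => (v + g t)%:E) <->
  long_occupation T1 H x (y - v) (fun t => (g t)%:E).
Proof.
split=> -[m [j [I [xI hI]]]]; exists m, j, I; split=> // i iI;
  have [T1i hi] := hI i iI; split=> // n k nk; have := hi n k nk;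
  by rewrite !lee_fin; move: (j.+1%:R^-1) => a ?; lra.
Qed.

Lemma long_occupation_mono T1 H x y y' f : y' <= y ->
  long_occupation T1 H x y f -> long_occupation T1 H x y' f.
Proof.
move=> yy [m [j [I [xI hI]]]]; exists m, j, I; split=> // i iI.
have [T1i hi] := hI i iI; split=> // n k nk; apply: le_trans (hi n k nk).
by rewrite lee_fin lerD2r.
Qed.

Lemma long_occupation_open T1 H x y f : long_occupation T1 H x y f ->
  exists2 y', y < y' & long_occupation T1 H x y' f.
Proof.
move=> [m [j [I [xI hI]]]].
have e0 : 0 < (j.*2.+1).+1%:R^-1 :> R by rewrite invr_gt0.
exists (y + (j.*2.+1).+1%:R^-1); first by rewrite ltrDl.
exists m, j.*2.+1, I; split=> // i iI.
have [T1i hi] := hI i iI; split=> // n k nk; apply: le_trans (hi n k nk).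
rewrite lee_fin -addrA lerD2l -doubleS -muln2 natrM invfM.
set a := _^-1; lra.
Qed.

(** The admissible levels form an open half-line, which is neither empty nor
    full since g is bounded on [T1, H]. *)
Lemma long_occupation_level T1 H x (g : R -> R) : 0 <= T1 < H -> 0 <= x < H - T1 ->
  continuous g -> exists z, forall y,
  long_occupation T1 H x y (fun t => (g t)%:E) <-> y < z.
Proof.
move=> T1H /andP[x0 xH] cg; have /andP[T10 T1H'] := T1H.
have cgE : {within `[T1, H], continuous (fun t => (g t)%:E)}.
  apply: continuous_subspaceT => t; apply: cvg_comp; first exact: cg.
  by [].
have cgW : {within `[T1, H], continuous g} by exact: continuous_subspaceT.
have [tm tmI tmP] := EVT_max (ltW T1H') cgW.
have [tn tnI tnP] := EVT_min (ltW T1H') cgW.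
pose K y := long_occupation T1 H x y (fun t => (g t)%:E).
have Klow y : y < g tn -> K y.
  move=> ytn; apply/long_occupationP => //.
  have [_ ->] := occupation_timeE y cgE.
  rewrite (_ : _ `&` _ = `[T1, H]%classic); last first.
    apply/seteqP; split=> [t []//|t tI]; split=> //=.
    by rewrite lte_fin (lt_le_trans ytn)//; apply: tnP.
  by rewrite /= lebesgue_measure_itv/= lte_fin T1H' -EFinD lte_fin.
have Khigh y : K y -> y < g tm.
  move/(long_occupationP _ _ T1H cgE); have [_ ->] := occupation_timeE y cgE.
  rewrite ltNge => xm; rewrite ltNge; apply/negP => gy; move: xm => /negP; apply.
  rewrite (_ : _ `&` _ = set0) ?measure0 ?lee_fin//.
  apply/seteqP; split=> // t [/= + tI]; rewrite lte_fin ltNge => /negP; apply.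
  by rewrite (le_trans _ gy)//; apply: tmP.
have hsK : has_sup K.
  split; first by exists (g tn - 1); apply: Klow; rewrite ltrBlDr ltrDl.
  by exists (g tm) => y /Khigh/ltW.
exists (sup K) => y; split.
  move=> Ky; have [y' yy' Ky'] := long_occupation_open Ky.
  by rewrite (lt_le_trans yy')//; apply: sup_upper_bound.
move=> yK; have [y' Ky' yy'] := sup_adherent (ltac:(by rewrite subr_gt0) : 0 < sup K - y) hsK.
by apply: long_occupation_mono Ky'; rewrite ltW//; move: yy'; rewrite subKr.
Qed.

End long_occupation_theory.


(** * First passages and the law of the maximum *)
Section exceedance.
Context {R : realType}.
Implicit Types (H u : R) (f : R -> R).

Definition exceeds H u f := exists2 t, 0 <= t <= H & u < f t.
Definition grid_exceeds H m u f :=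
  exists2 k, (k <= 2 ^ m)%N & u < f (dyadic H m k).
Definition ever_exceeds u f := exists2 t, 0 <= t & u < f t.

Lemma exceedsP H u f : 0 < H -> continuous f ->
  exceeds H u f <-> exists m, grid_exceeds H m u f.
Proof.
move=> H0 cf; split=> [[t /andP[t0 tH] uft]|[m [k km ufk]]]; last first.
  exists (dyadic H m k) => //.
  rewrite -{1}(dyadic0 H m) ler_dyadic// leq0n/=.
  by rewrite -[leRHS](dyadic_end H m) ler_dyadic.
have [tHE|tnH] := eqVneq t H.
  by exists 0%N, 1%N => //; rewrite -{1}(expn0 2) dyadic_end -tHE.
have {tH tnH}tH : t < H by rewrite lt_neqAle tnH.
have : \forall s \near t, u < f s by apply: (cvgr_gt _ (cf t)).
move=> /nbhs_ballP[e /= e0 teu].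
have tc : dyadic H 0 0 <= t < dyadic H 0 1.
  by rewrite dyadic0 t0/= -{1}(expn0 2) dyadic_end.
have [n [k [/andP[_ kH] tk]]] := dyadic_cell_dense H0 e0 tc.
exists n, k; last exact: teu.
by rewrite -(ler_dyadic n _ _ H0) dyadic_end (le_trans kH)// -{1}(expn0 2) dyadic_end.
Qed.

Lemma grid_exceeds_refine H m n u f : (m <= n)%N ->
  grid_exceeds H m u f -> grid_exceeds H n u f.
Proof.
move=> mn [k km ufk]; exists (k * 2 ^ (n - m))%N.
  by rewrite -{2}(subnKC mn) expnD leq_mul2r km orbT.
by rewrite -{1}(subnKC mn) -dyadic_refine.
Qed.

Section exceedance_probability.
Context d (T : measurableType d) (mu : {measure set T -> \bar R}).
Variables (Y : R -> T -> R) (u : R).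
Hypotheses (mY : forall t, measurable_fun setT (Y t)).
Hypotheses (cY : forall o, continuous (Y ^~ o)).

Lemma measurable_above t : measurable [set o | u < Y t o].
Proof.
rewrite (_ : [set o | _] = Y t @^-1` `]u, +oo[%classic).
  by rewrite -[X in measurable X]setTI; exact: mY.
by apply/seteqP; split=> o /=; rewrite in_itv/= andbT.
Qed.

Lemma measurable_grid_exceeds H m :
  measurable [set o | grid_exceeds H m u (Y ^~ o)].
Proof.
rewrite (_ : [set o | _] = \bigcup_(k in `I_(2 ^ m).+1) [set o | u < Y (dyadic H m k) o]).
  by apply: fin_bigcup_measurable => // k _; exact: measurable_above.
by apply/seteqP; split=> o [k km uk]; exists k.
Qed.

Lemma exceeds_bigcup H : 0 < H ->
  [set o | exceeds H u (Y ^~ o)] = \bigcup_m [set o | grid_exceeds H m u (Y ^~ o)].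
Proof.
move=> H0; apply/seteqP; split=> o /=.
  by move/(exceedsP u H0 (@cY o)) => [m h]; exists m.
by move=> [m _ h]; apply/(exceedsP u H0 (@cY o)); exists m.
Qed.

Lemma measurable_exceeds H : 0 < H -> measurable [set o | exceeds H u (Y ^~ o)].
Proof.
move=> H0; rewrite exceeds_bigcup//; apply: bigcupT_measurable => m.
exact: measurable_grid_exceeds.
Qed.

Lemma exceeds_cvg H : 0 < H ->
  mu [set o | grid_exceeds H m u (Y ^~ o)] @[m --> \oo] -->
  mu [set o | exceeds H u (Y ^~ o)].
Proof.
move=> H0; rewrite exceeds_bigcup//; apply: nondecreasing_cvg_mu.
- by move=> m; exact: measurable_grid_exceeds.
- by apply: bigcupT_measurable => m; exact: measurable_grid_exceeds.
- by move=> m n mn; apply/subsetPset => o; exact: grid_exceeds_refine.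
Qed.

Lemma ever_exceeds_bigcup : [set o | ever_exceeds u (Y ^~ o)] =
  \bigcup_n [set o | exceeds n.+1%:R u (Y ^~ o)].
Proof.
apply/seteqP; split=> o /=.
  move=> [t t0 ut]; exists (Num.truncn t) => //; exists t => //.
  by rewrite t0/= ltW//; exact: truncnS_gt.
by move=> [n _ [t /andP[t0 _] ut]]; exists t.
Qed.

Lemma measurable_ever_exceeds : measurable [set o | ever_exceeds u (Y ^~ o)].
Proof.
rewrite ever_exceeds_bigcup; apply: bigcupT_measurable => n.
by apply: measurable_exceeds; rewrite ltr0n.
Qed.

Lemma ever_exceeds_cvg :
  mu [set o | exceeds n.+1%:R u (Y ^~ o)] @[n --> \oo] -->
  mu [set o | ever_exceeds u (Y ^~ o)].
Proof.
rewrite ever_exceeds_bigcup; apply: nondecreasing_cvg_mu.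
- by move=> n; apply: measurable_exceeds; rewrite ltr0n.
- by apply: bigcupT_measurable => n; apply: measurable_exceeds; rewrite ltr0n.
- move=> m n mn; apply/subsetPset => o [t /andP[t0 tm] ut]; exists t => //.
  by rewrite t0 (le_trans tm)// ler_nat.
Qed.

End exceedance_probability.

Lemma ever_exceeds_law_unique d (T : measurableType d) d' (T' : measurableType d')
    (mu : {measure set T -> \bar R}) (nu : {measure set T' -> \bar R})
    (Y : R -> T -> R) (Z : R -> T' -> R) u :
  (forall t, measurable_fun setT (Y t)) -> (forall t, measurable_fun setT (Z t)) ->
  (forall o, continuous (Y ^~ o)) -> (forall o, continuous (Z ^~ o)) ->
  (forall H m, 0 < H -> mu [set o | grid_exceeds H m u (Y ^~ o)] =
     nu [set o | grid_exceeds H m u (Z ^~ o)]) ->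
  mu [set o | ever_exceeds u (Y ^~ o)] = nu [set o | ever_exceeds u (Z ^~ o)].
Proof.
move=> mY mZ cY cZ munu.
have cm := @ever_exceeds_cvg _ _ mu Y u mY cY.
have cn := @ever_exceeds_cvg _ _ nu Z u mZ cZ.
apply: (cvg_unique _ cm) => //.
rewrite (_ : (fun n => _) = (fun n => nu [set o | exceeds n.+1%:R u (Z ^~ o)]))//.
apply/funext => n; have n0 : 0 < n.+1%:R :> R by rewrite ltr0n.
have cm' := @exceeds_cvg _ _ mu Y u mY cY _ n0.
have cn' := @exceeds_cvg _ _ nu Z u mZ cZ _ n0.
apply: (cvg_unique _ cm') => //.
rewrite (_ : (fun n => _) = (fun m => nu [set o | grid_exceeds n.+1%:R m u (Z ^~ o)]))//.
by apply/funext => m; exact: munu.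
Qed.

End exceedance.

Section first_passage.
Context {R : realType}.

Definition first_passage (u : R) k : set (nat -> R) :=
  [set a : nat -> R | u < \sum_(j < k) a j /\ forall i, (i < k)%N -> \sum_(j < i) a j <= u].

Lemma measurable_first_passage u k : <<s rectangles k >> (first_passage u k).
Proof.
have mS i : (i <= k)%N -> measurable_fun setT
    (fun a : g_sigma_algebraType (@rectangles R k) => \sum_(j < i) a j).
  exact: measurable_partial_sum.
suff : @measurable _ (g_sigma_algebraType (@rectangles R k)) (first_passage u k) by [].
rewrite (_ : first_passage u k =
   ((fun a : nat -> R => \sum_(j < k) a j) @^-1` `]u, +oo[%classic) `&`
   \bigcap_(i in `I_k) ((fun a : nat -> R => \sum_(j < i) a j) @^-1` `]-oo, u]%classic)).
  apply: measurableI; first by rewrite -[X in measurable X]setTI; exact: mS.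
  apply: fin_bigcap_measurable => // i /= ik.
  by rewrite -[X in measurable X]setTI; apply: mS => //; exact: ltnW.
apply/seteqP; split=> a /=; rewrite !in_itv/= andbT => -[h1 h2]; split=> //.
Qed.

Lemma exists_first_passage u n (a : nat -> R) :
  (exists2 k, (k <= n)%N & u < \sum_(j < k) a j) <->
  (exists2 k, (k <= n)%N & first_passage u k a).
Proof.
split=> -[k kn hk]; last by exists k => //; case: hk.
have ex : exists k, u < \sum_(j < k) a j by exists k.
exists (ex_minn ex); case: ex_minnP => m hm minm.
  by rewrite (leq_trans _ kn)//; exact: minm.
by split=> // i im; rewrite leNgt; apply/negP => /minm; rewrite leqNgt im.
Qed.

Lemma first_passage_unique u k l a :
  first_passage u k a -> first_passage u l a -> k = l.
Proof.
move=> [h1 h2] [h3 h4]; case: (ltngtP k l) => // kl.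
  by have := h4 _ kl; rewrite leNgt h1.
by have := h2 _ kl; rewrite leNgt h3.
Qed.

End first_passage.


Section maximum_of_drifted_brownian_motion.
Context (R : realType) (d : measure_display) (T : measurableType d).
Context (P : probability T R) (B : R -> {RV P >-> R}) (c : R).
Hypotheses (hB : two_sided_brownian_motion B) (c0 : 0 < c).
Local Notation X := (drifted B c).
Local Notation dX := (increment B c).

Let mX t : measurable_fun setT (X t). Proof. exact: measurable_drifted. Qed.
Let mN t : measurable_fun setT (fun o => - X t o).
Proof. exact: measurableT_comp. Qed.
Let cX o : continuous (X ^~ o). Proof. exact: continuous_drifted. Qed.
Let cN o : continuous (fun t => - X t o).
Proof. by move=> t; apply: cvgN; exact: cX. Qed.

Let passage (u : R) H m k : set T :=
  [set o | first_passage u k (fun i => - dX (dyadic H m) i o)].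

Let measurable_passage u H m k : measurable (passage u H m k).
Proof.
apply: (@measurable_grid_event _ _ _ k (fun i o => - dX (dyadic H m) i o) _ _
  (@measurable_first_passage R u k)) => i.
by apply: measurableT_comp => //; exact: measurable_increment.
Qed.

Let sum_neg H m n o : \sum_(i < n) - dX (dyadic H m) i o = - X (dyadic H m n) o.
Proof. by rewrite sumrN sum_increment dyadic0 (drifted0 c hB) subr0. Qed.

Let sum_pos H m n o : \sum_(i < n) dX (dyadic H m) i o = X (dyadic H m n) o.
Proof. by rewrite sum_increment dyadic0 (drifted0 c hB) subr0. Qed.

Let measure_union_passages (mu : {measure set T -> \bar R}) u (a : T -> nat -> R) n
    (A : nat -> set T) : (forall k, measurable ([set o | first_passage u k (a o)] `&` A k)) ->
  mu [set o | exists2 k, (k <= n)%N & first_passage u k (a o) /\ A k o] =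
  (\sum_(k < n.+1) mu ([set o | first_passage u k (a o)] `&` A k))%E.
Proof.
move=> mA; pose F k := [set o | first_passage u k (a o)] `&` A k.
transitivity (mu (\big[setU/set0]_(k < n.+1) F k)).
  by rewrite -bigcup_mkord; congr (mu _); apply/seteqP; split=> o [k kn hk]; exists k.
apply: measure_semi_additive_ord_I; [by move=> k _; exact: mA| |
  by apply: bigsetU_measurable => k _; exact: mA].
apply/trivIsetP => k l _ _ kl; apply/seteqP; split=> // o [[h1 _] [h2 _]].
by move/eqP : kl; apply; exact: first_passage_unique h1 h2.
Qed.

Let grid_exceeds_passage u H m : 0 < H ->
  P [set o | grid_exceeds H m u (X ^~ o)] =
  (\sum_(k < (2 ^ m).+1)
     \int[P]_(o in passage u H m k) (girsanov_weight B c (dyadic H m k) o)%:E)%E.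
Proof.
move=> H0; rewrite (_ : [set o | _] = [set o | exists2 k, (k <= 2 ^ m)%N &
    first_passage u k (dX (dyadic H m) ^~ o) /\ setT o]); last first.
  apply/seteqP; split=> o /=.
    move=> [k km uk]; have /(exists_first_passage u (2 ^ m) (dX (dyadic H m) ^~ o))[l lm hl] :
      exists2 k, (k <= 2 ^ m)%N & u < \sum_(j < k) dX (dyadic H m) j o by exists k => //; rewrite sum_pos.
    by exists l.
  by move=> [k km [[uk _] _]]; exists k => //; rewrite -sum_pos.
rewrite (@measure_union_passages P u (fun o => dX (dyadic H m) ^~ o) (2 ^ m) (fun=> setT)).
  apply: eq_bigr => k _; rewrite setIT.
  apply/esym; exact: (grid_girsanov c hB (dyadic0 H m) (fun i => ltr_dyadic m i H0)
      (@measurable_first_passage R u k)).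
move=> k; rewrite setIT.
apply: (@measurable_grid_event _ _ _ k (dX (dyadic H m)) _ _
  (@measurable_first_passage R u k)) => i.
exact: measurable_increment.
Qed.

(** Decompose on the index k of the first passage above u.  The change of
    measure at the k-th grid point, which sees only what happened up to then,
    turns the passage of X into a passage of -X; there the weight is
    exp (- 2 c (- X)) with -X > u. *)
Lemma grid_exceeds_le u H m : 0 < H ->
  (P [set o | grid_exceeds H m u (X ^~ o)] <= (expR (- (2 * c * u)))%:E *
   P [set o | grid_exceeds H m u (fun t => (- X t o)%R)])%E.
Proof.
move=> H0; rewrite grid_exceeds_passage//.
rewrite (_ : [set o | grid_exceeds _ _ _ _] = [set o | exists2 k, (k <= 2 ^ m)%N &
    first_passage u k (fun i => - dX (dyadic H m) i o) /\ setT o]); last first.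
  apply/seteqP; split=> o /=.
    move=> [k km uk]; have /(exists_first_passage u (2 ^ m) (fun i => - dX (dyadic H m) i o))[l lm hl] :
      exists2 k, (k <= 2 ^ m)%N & u < \sum_(j < k) - dX (dyadic H m) j o by exists k => //; rewrite sum_neg.
    by exists l.
  by move=> [k km [[uk _] _]]; exists k => //; rewrite -sum_neg.
rewrite (@measure_union_passages P u (fun o i => - dX (dyadic H m) i o) (2 ^ m) (fun=> setT)); last first.
  by move=> k; rewrite setIT; exact: measurable_passage.
rewrite ge0_sume_distrr//; apply: lee_sum => k _; rewrite setIT.
rewrite -integral_cst//; last exact: measurable_passage.
apply: ge0_le_integral => //.
- by move=> o _; rewrite lee_fin expR_ge0.
- apply/measurable_EFinP/measurable_funTS; exact: measurable_girsanov_weight.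
- move=> o [uk _]; rewrite lee_fin ler_expR; move: uk; rewrite sum_neg.
  by move=> ?; rewrite -mulrN ler_pM2l ?mulr_gt0//; lra.
Qed.

(** The converse of [grid_exceeds_le] for the passages that overshoot u by eta
    at most. *)
Lemma grid_exceeds_ge u eta H m : 0 < H ->
  ((expR (- (2 * c * (u + eta))))%:E *
   P [set o | exists2 k, (k <= 2 ^ m)%N &
        first_passage u k (fun i => (- dX (dyadic H m) i o)%R) /\
        (- X (dyadic H m k) o <= u + eta)%R] <=
   P [set o | grid_exceeds H m u (X ^~ o)])%E.
Proof.
move=> H0; rewrite grid_exceeds_passage//.
pose A k := [set o | - X (dyadic H m k) o <= u + eta].
have mA k : measurable (A k).
  rewrite (_ : A k = (fun o => - X (dyadic H m k) o) @^-1` `]-oo, u + eta]%classic).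
    by rewrite -[X in measurable X]setTI; exact: mN.
  by apply/seteqP; split=> o /=; rewrite in_itv.
have mAk k : measurable (passage u H m k `&` A k).
  by apply: measurableI => //; exact: measurable_passage.
rewrite (@measure_union_passages P u (fun o i => - dX (dyadic H m) i o) (2 ^ m) A)//.
rewrite ge0_sume_distrr//; apply: lee_sum => k _.
rewrite -integral_cst//; last exact: mAk.
have mw (D : set T) : measurable_fun D (fun o => (girsanov_weight B c (dyadic H m k) o)%:E).
  by apply/measurable_EFinP/measurable_funTS; exact: measurable_girsanov_weight.
have w0 o : (0 <= (girsanov_weight B c (dyadic H m k) o)%:E)%E by rewrite lee_fin expR_ge0.
apply: (@le_trans _ _ (\int[P]_(o in passage u H m k `&` A k)
   (girsanov_weight B c (dyadic H m k) o)%:E)%E).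
  apply: ge0_le_integral => //; [exact: mAk|by move=> o _; rewrite lee_fin expR_ge0|].
  move=> o [_ h]; rewrite lee_fin ler_expR; move: h; rewrite /A /=.
  by move=> ?; rewrite -mulrN ler_pM2l ?mulr_gt0//; lra.
by apply: ge0_subset_integral => //; exact: subIsetl.
Qed.

End maximum_of_drifted_brownian_motion.


Section small_overshoot.
Context {R : realType}.
Implicit Types (H u eta : R) (g : R -> R).

(** Let tau be the infimum of the times at which g > u.  Then g tau <= u, so
    that g <= u + eta shortly after tau.  Points with g > u exist in every right
    neighbourhood of tau, hence on all fine grids, and the first passage on such
    a grid happens between tau and those points. *)
Lemma small_overshoot H u eta g : 0 < H -> 0 < eta -> continuous g ->
  g 0 <= u -> u < g H ->
  exists m0, forall m, (m0 <= m)%N -> exists2 k, (k <= 2 ^ m)%N &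
    [/\ u < g (dyadic H m k), forall i, (i < k)%N -> g (dyadic H m i) <= u &
        g (dyadic H m k) <= u + eta].
Proof.
move=> H0 eta0 cg g0u ugH.
pose S := [set t | 0 <= t <= H /\ u < g t].
have SH : S H by split=> //; rewrite lexx ltW.
have hiS : has_inf S by split; [exists H|exists 0 => t [/andP[]]].
pose tau := inf S.
have tauS t : S t -> tau <= t by move=> St; apply: inf_lbound => //; case: hiS.
have tau0 : 0 <= tau by apply: lb_le_inf; [exists H|move=> t [/andP[]]].
have gtau : g tau <= u.
  rewrite leNgt; apply/negP => ugtau.
  have [tauE|taun0] := eqVneq tau 0; first by move: ugtau; rewrite tauE ltNge g0u.
  have : \forall s \near tau, u < g s by apply: (cvgr_gt _ (cg tau)).
  move=> /nbhs_ballP[e /= e0 teu].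
  pose s := tau - Num.min tau e / 2.
  have taupos : 0 < tau by rewrite lt_neqAle eq_sym taun0.
  have m0 : 0 < Num.min tau e by rewrite lt_min taupos.
  have mtau : Num.min tau e <= tau by rewrite ge_min lexx.
  have me : Num.min tau e <= e by rewrite ge_min lexx orbT.
  have st : s < tau by rewrite /s; lra.
  have : S s.
    have := tauS _ SH => tauH.
    split; first by apply/andP; split; rewrite /s; lra.
    apply: teu; rewrite /ball/= /s ltr_norml; apply/andP; split; lra.
  by move/tauS; rewrite leNgt st.
have : \forall s \near tau, g s < u + eta.
  by apply: (cvgr_lt _ (cg tau)); rewrite (le_lt_trans gtau)// ltrDl.
move=> /nbhs_ballP[e /= e0 teu].
have [s Ss stau] := inf_adherent e0 hiS.
(* h > 0 singles out the points with g > u that are close to tau, so that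
   finding one of them on a grid is again an exceedance *)
pose h t := Num.min (g t - u) (tau + e - t).
have ch : continuous h.
  move=> t; apply: (@continuous_min _ _ (fun t => g t - u) (fun t => tau + e - t)).
    by apply: cvgB; [exact: cg|exact: cvg_cst].
  by apply: cvgB; [exact: cvg_cst|exact: cvg_id].
have hs : 0 < h s by rewrite /h lt_min !subr_gt0 stau; case: Ss => _ ->.
have /(exceedsP 0 H0 ch)[m0 hm0] : exceeds H 0 h.
  by exists s => //; case: Ss.
exists m0 => m m0m.
have [k km] := grid_exceeds_refine m0m hm0.
rewrite /h lt_min !subr_gt0 => /andP[ugk ktau].
have ex : exists k, u < g (dyadic H m k) by exists k.
exists (ex_minn ex); case: ex_minnP => l ul minl; have lk := minl _ ugk.
  exact: leq_trans km.
split=> //.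
  by move=> i il; rewrite leNgt; apply/negP => /minl; rewrite leqNgt il.
have Sl : S (dyadic H m l).
  split=> //; rewrite -{1}(dyadic0 H m) ler_dyadic// leq0n/=.
  by rewrite -[leRHS](dyadic_end H m) ler_dyadic// (leq_trans lk).
have lk' : dyadic H m l <= dyadic H m k by rewrite ler_dyadic.
have tl := tauS _ Sl.
apply/ltW/teu; rewrite /ball/= ltr_norml; apply/andP; split; lra.
Qed.

End small_overshoot.

Section law_of_the_maximum.
Context (R : realType) (d : measure_display) (T : measurableType d).
Context (P : probability T R) (B : R -> {RV P >-> R}) (c : R).
Hypotheses (hB : two_sided_brownian_motion B) (c0 : 0 < c).
Local Notation X := (drifted B c).
Local Notation dX := (increment B c).

Let mX t : measurable_fun setT (X t). Proof. exact: measurable_drifted. Qed.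
Let mN t : measurable_fun setT (fun o => - X t o).
Proof. exact: measurableT_comp. Qed.
Let cX o : continuous (X ^~ o). Proof. exact: continuous_drifted. Qed.
Let cN o : continuous (fun t => - X t o).
Proof. by move=> t; apply: cvgN; exact: cX. Qed.

Lemma exceeds_le u H : 0 < H ->
  (P [set o | exceeds H u (X ^~ o)] <= (expR (- (2 * c * u)))%:E *
   P [set o | exceeds H u (fun t => (- X t o)%R)])%E.
Proof.
move=> H0; apply: (cvge_le _ (@exceeds_cvg R _ _ P X u mX cX _ H0)).
apply: nearW => m; apply: le_trans (grid_exceeds_le hB c0 u m H0) _.
rewrite lee_wpmul2l ?lee_fin ?expR_ge0//; apply: le_measure; rewrite ?inE.
- exact: (@measurable_grid_exceeds R _ _ (fun t o => - X t o) u mN).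
- exact: (@measurable_exceeds R _ _ (fun t o => - X t o) u mN cN).
- by move=> o h; apply/(exceedsP u H0 (@cN o)); exists m.
Qed.

Lemma ever_exceeds_le u :
  (P [set o | ever_exceeds u (X ^~ o)] <= (expR (- (2 * c * u)))%:E)%E.
Proof.
apply: (cvge_le _ (@ever_exceeds_cvg R _ _ P X u mX cX)).
apply: nearW => n; have n0 : 0 < n.+1%:R :> R by rewrite ltr0n.
apply: le_trans (exceeds_le u n0) _; rewrite -[leRHS]mule1.
rewrite lee_wpmul2l ?lee_fin ?expR_ge0//; apply: probability_le1.
exact: (@measurable_exceeds R _ _ (fun t o => - X t o) u mN cN).
Qed.

Let measurable_above_neg u t : measurable [set o | u < - X t o].
Proof. exact: (@measurable_above R _ _ (fun t o => - X t o) u mN). Qed.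

(** If -X ends above u, its first passage has an overshoot of at most eta on all
    fine grids.  This event is thus contained in the limit inferior of the grid
    events of [grid_exceeds_ge]. *)
Lemma exceeds_ge_overshoot u eta H : 0 <= u -> 0 < eta -> 0 < H ->
  ((expR (- (2 * c * (u + eta))))%:E * P [set o | (u < - X H o)%R] <=
   P [set o | exceeds H u (X ^~ o)])%E.
Proof.
move=> u0 eta0 H0.
pose A m := [set o | exists2 k, (k <= 2 ^ m)%N &
  first_passage u k (fun i => - dX (dyadic H m) i o) /\ - X (dyadic H m k) o <= u + eta].
have AE m : A m = \bigcup_(k in `I_(2 ^ m).+1)
   ([set o | first_passage u k (fun i => - dX (dyadic H m) i o)] `&`
    (fun o => - X (dyadic H m k) o) @^-1` `]-oo, u + eta]%classic).
  apply/seteqP; split=> o.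
    by move=> [k km [h1 h2]]; exists k => //; split => //=; rewrite in_itv.
  by move=> [k km [h1]]; rewrite /= in_itv/= => h2; exists k.
have mA m : measurable (A m).
  rewrite AE; apply: fin_bigcup_measurable => // k _; apply: measurableI.
    apply: (@measurable_grid_event _ _ _ k (fun i o => - dX (dyadic H m) i o) _ _
      (@measurable_first_passage R u k)) => i.
    by apply: measurableT_comp => //; exact: measurable_increment.
  by rewrite -[X in measurable X]setTI; exact: mN.
pose C M := \bigcap_(m in [set m | (M <= m)%N]) A m.
have mC M : measurable (C M) by apply: bigcap_measurable => //; exists M => /=.
have mUC : measurable (\bigcup_M C M) by exact: bigcupT_measurable.
have CC : P (C M) @[M --> \oo] --> P (\bigcup_M C M).
  apply: nondecreasing_cvg_mu => // m n mn; apply/subsetPset => o Cm k /= nk.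
  by apply: Cm => /=; exact: leq_trans nk.
have sub : [set o | u < - X H o] `<=` \bigcup_M C M.
  move=> o /= uX.
  have X0 : - X 0 o <= u by rewrite (drifted0 c hB) oppr0.
  have [m0 hm0] := small_overshoot H0 eta0 (@cN o) X0 uX.
  exists m0 => // m /= m0m; have [k km [h1 h2 h3]] := hm0 m m0m.
  have S n : \sum_(i < n) - dX (dyadic H m) i o = - X (dyadic H m n) o.
    by rewrite sumrN sum_increment dyadic0 (drifted0 c hB) subr0.
  exists k => //; split=> //; split; first by rewrite S.
  by move=> i ik; rewrite S; exact: h2.
apply: (@le_trans _ _ ((expR (- (2 * c * (u + eta))))%:E * P (\bigcup_M C M))%E).
  rewrite lee_wpmul2l ?lee_fin ?expR_ge0//; apply: le_measure; rewrite ?inE//.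
have kC : ((expR (- (2 * c * (u + eta))))%:E * P (C M))%E @[M --> \oo] -->
    ((expR (- (2 * c * (u + eta))))%:E * P (\bigcup_M C M))%E.
  exact: cvgeZl.
apply: (cvge_le _ kC); apply: nearW => M.
apply: (@le_trans _ _ ((expR (- (2 * c * (u + eta))))%:E * P (A M))%E).
  rewrite lee_wpmul2l ?lee_fin ?expR_ge0//; apply: le_measure; rewrite ?inE//.
  by move=> o; apply => /=.
apply: le_trans (grid_exceeds_ge hB c0 u eta M H0) _.
apply: le_measure; rewrite ?inE.
- exact: (@measurable_grid_exceeds R _ _ X u mX).
- exact: (@measurable_exceeds R _ _ X u mX cX).
- by move=> o h; apply/(exceedsP u H0 (@cX o)); exists M.
Qed.

(** Markov's inequality for exp (c X(H)), whose expectation exp (- c^2 H / 2)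
    comes from the change of measure for the drift c / 2. *)
Lemma drifted_tail u H : 0 < H ->
  ((1 - expR (- (c * (c * H / 2 - u))))%:E <= P [set o | (u < - X H o)%R])%E.
Proof.
move=> H0; set A := [set o | _].
have mA : measurable A by exact: measurable_above_neg.
have PAC : (P (~` A) <= (expR (- (c * (c * H / 2 - u))))%:E)%E.
  pose w := girsanov_weight B (c / 2) H.
  have mw : measurable_fun setT (fun o => (w o)%:E).
    by apply/measurable_EFinP; exact: measurable_girsanov_weight.
  have w0 o : (0 <= (w o)%:E)%E by rewrite lee_fin expR_ge0.
  have w1 : (\int[P]_o (w o)%:E = 1)%E.
    have := path_girsanov (c / 2) hB H0 (@sigma_setT _ (cylinders H)).
    by rewrite -(@probability_setT _ _ _ P).
  have mAC : measurable (~` A) by exact: measurableC.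
  apply: (@le_trans _ _ (\int[P]_(o in ~` A) ((expR (- (c * (c * H / 2 - u))))%:E * (w o)%:E)))%E.
    rewrite -[leLHS]mul1e -integral_cst//; apply: ge0_le_integral => //.
    - by apply: measurable_funTS; exact: measurable_funeM.
    - move=> o; rewrite /A /= => /negP; rewrite -leNgt => Xu.
      rewrite -EFinM lee_fin /w /girsanov_weight -expRD -[leLHS]expR0 ler_expR.
      move: Xu; rewrite /drifted; set b := (B H o : R); move=> Xu.
      have := ltW c0; nra.
  rewrite ge0_integralZl ?lee_fin ?expR_ge0//; last exact: measurable_funTS.
  rewrite -[leRHS]mule1 lee_wpmul2l ?lee_fin ?expR_ge0// -w1.
  exact: ge0_subset_integral.
have -> : P A = (1 - P (~` A))%E.
  by rewrite -[in LHS](setCK A) probability_setC//; exact: measurableC.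
by rewrite EFinB; apply: leeB.
Qed.

(** The upper bound is [exceeds_le] with the probability on its right-hand side
    bounded by 1.  The probability in [exceeds_ge_overshoot] tends to 1 with the
    horizon, because -X has drift c > 0, and this gives the lower bound. *)
Theorem ever_exceeds_probability u : 0 <= u ->
  P [set o | ever_exceeds u (X ^~ o)] = (expR (- (2 * c * u)))%:E.
Proof.
move=> u0; apply/eqP; rewrite eq_le ever_exceeds_le/=.
apply/lee_addgt0Pr => e e0.
(* eta makes exp (- 2 c eta) >= 1 - e / 2, and the horizon H makes the tail
   exp (- (c (c H / 2 - u))) at most e / 2 *)
pose eta := e / 2 / (2 * c).
pose H := 2 / c * (u + 2 / e / c).
have eta0 : 0 < eta by rewrite /eta !divr_gt0// mulr_gt0.
have H0 : 0 < H.
  by rewrite /H mulr_gt0 ?divr_gt0// ltr_wpDl// !divr_gt0.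
have step := exceeds_ge_overshoot u0 eta0 H0.
have tail := drifted_tail u H0.
have mE : measurable [set o | exceeds H u (X ^~ o)].
  exact: (@measurable_exceeds R _ _ X u mX cX).
have ee : (P [set o | exceeds H u (X ^~ o)] <= P [set o | ever_exceeds u (X ^~ o)])%E.
  apply: le_measure; rewrite ?inE//.
    exact: (@measurable_ever_exceeds R _ _ X u mX cX).
  by move=> o [t /andP[t0 _] ut]; exists t.
rewrite -leeBlDr//; apply: le_trans ee; apply: le_trans step.
apply: le_trans (lee_wpmul2l _ tail); last by rewrite lee_fin expR_ge0.
rewrite -EFinB -EFinM lee_fin.
have -> : - (2 * c * (u + eta)) = - (2 * c * u) + - (e / 2).
  by rewrite /eta; field; rewrite gt_eqF.
rewrite expRD; set k := expR (- (2 * c * u)).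
have k1 : k <= 1 by rewrite -expR0 ler_expR oppr_le0 !mulr_ge0// ltW.
have k0 : 0 <= k := expR_ge0 _.
have h1 := expR_ge1Dx (- (e / 2)).
have h2 : expR (- (c * (c * H / 2 - u))) <= e / 2.
  have -> : c * (c * H / 2 - u) = 2 / e by rewrite /H; field; rewrite !gt_eqF.
  rewrite expRN -[leRHS]invrK invf_div lef_pV2 ?posrE ?expR_gt0 ?divr_gt0//.
  by rewrite (le_trans _ (expR_ge1Dx _))// lerDr.
have h3 := expR_ge0 (- (c * (c * H / 2 - u))).
have h4 := expR_ge0 (- (e / 2)).
have h5 : expR (- (e / 2)) <= 1 by rewrite -expR0 ler_expR oppr_le0 divr_ge0// ltW.
set a := expR _ in h1 h4 h5 *; set b := expR _ in h2 h3 *.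
have kab : k * a * b <= b.
  by rewrite ler_piMl// mulr_ile1.
have ka : k * (1 - e / 2) <= k * a by apply: ler_wpM2l => //; lra.
have ke : k * (e / 2) <= e / 2 by rewrite ler_piMl// divr_ge0// ltW.
rewrite mulrBr mulr1; move: kab ka ke; rewrite mulrBr mulr1 => *; lra.
Qed.

End law_of_the_maximum.


(** * The workload after a high start *)
Section backlog.
Context {R : realType}.
Implicit Types (f : R -> R) (t u v H : R).

Definition backlog f t : \bar R :=
  ereal_sup [set (f s - f t)%:E | s in [set s | t <= s]].

Lemma lt_backlog f t v : (v%:E < backlog f t)%E <-> exists2 s, t <= s & v < f s - f t.
Proof.
split; first by move/ereal_sup_gtP => [_ [s ts <-]]; rewrite lte_fin; exists s.
by move=> [s ts vs]; apply/ereal_sup_gtP; exists (f s - f t)%:E; [exists s|rewrite lte_fin].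
Qed.

Lemma lt_backlog_shift f t H v : ((v - (f H - f t))%:E < backlog f H)%E <->
  (v%:E < (f H - f t)%:E + backlog f H)%E.
Proof. by rewrite EFinB lteBlDl. Qed.

Lemma eq_ereal_lt (a b : \bar R) :
  (forall v, (v%:E < a)%E <-> (v%:E < b)%E) -> a = b.
Proof.
move=> ab; wlog ltab : a b ab / (a < b)%E.
  move=> W; case: (ltgtP a b) => // [h|h]; first exact: W.
  by apply/esym/W => // v; split => /ab.
exfalso; move: ab ltab; case: a => [r| |]; case: b => [s| |] //= ab.
- by move=> rs; have /ab := rs; rewrite ltxx.
- by move=> _; have /ab := ltry r; rewrite ltxx.
- by move=> _; have /ab : ((s - 1)%:E < s%:E)%E by rewrite lte_fin ltrBlDr ltrDl.
- by move=> _; have := (ab 0).2 (ltry 0).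
Qed.

(** Somewhere after H the path exceeds u, hence all its values before H, so that
    only the times after H matter for the supremum defining the backlog. *)
Lemma backlog_before f H u : (forall t, 0 <= t <= H -> f t <= u) ->
  (u%:E < (f H)%:E + backlog f H)%E ->
  forall t, 0 <= t <= H -> backlog f t = ((f H - f t)%:E + backlog f H)%E.
Proof.
move=> fu uH t tH; have /andP[t0 tH'] := tH; apply: eq_ereal_lt => v.
have [r Hr ur] : exists2 r, H <= r & u < f r.
  have : ((u - f H)%:E < backlog f H)%E by rewrite EFinB lteBlDl.
  by move/lt_backlog => [r Hr]; rewrite ltrD2r; exists r.
split.
  move/lt_backlog => [s ts vs]; apply/lt_backlog_shift/lt_backlog.
  case: (lerP H s) => Hs; first by exists s => //; lra.
  have fs : f s <= u by apply: fu; rewrite (le_trans t0)//= ltW.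
  by exists r => //; lra.
move/lt_backlog_shift/lt_backlog => [s Hs vs]; apply/lt_backlog.
by exists s; [exact: le_trans Hs|lra].
Qed.

Lemma backlog_ge0 f t : (0 <= backlog f t)%E.
Proof.
by apply: ereal_sup_ubound; exists t => /=; rewrite ?subrr.
Qed.

(** The two conditions on the backlog become two lower bounds on the single
    number backlog f H.  An infinite backlog satisfies all of them. *)
Lemma long_occupation_backlog T1 H x y u z f :
  0 <= T1 < H -> 0 <= x < H - T1 -> f 0 = 0 ->
  (forall y, long_occupation T1 H x y (fun t => (- f t)%:E) <-> y < z) ->
  ~ exceeds H u f ->
  long_occupation T1 H x y (backlog f) /\ (u%:E < backlog f 0)%E <->
  ((Num.max u (y - z) - f H)%:E < backlog f H)%E.
Proof.
move=> T1H xH f0 zP nu; have H0 : 0 < H by case/andP : T1H => ?; exact: le_lt_trans.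
have fu t : 0 <= t <= H -> f t <= u.
  by move=> tH; rewrite leNgt; apply/negP => uft; apply: nu; exists t.
have K : (u%:E < (f H)%:E + backlog f H)%E ->
    long_occupation T1 H x y (backlog f) <-> ((y - z - f H)%:E < backlog f H)%E.
  move=> uH; have E := backlog_before fu uH.
  have := backlog_ge0 f H; case: (backlog f H) E => [e| |//] E e0.
    rewrite lte_fin; apply: (@iff_trans _ (y - (f H + e) < z)); last by split; lra.
    rewrite -zP -long_occupation_shift; split; apply: long_occupation_ext => // t tH.
      by rewrite E// -EFinD; congr EFin; ring.
    by rewrite E// -EFinD; congr EFin; ring.
  split; first by rewrite ltry.
  move=> _; apply: (@long_occupation_ext _ _ _ _ _ (cst +oo%E)) => //.
    by move=> t tH; rewrite E// addey.
  have c : {within `[T1, H], continuous (cst +oo%E : R -> \bar R)}.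
    by apply: continuous_subspaceT => t; exact: cvg_cst.
  apply/long_occupationP => //; have [_ ->] := occupation_timeE y c.
  rewrite (_ : _ `&` _ = `[T1, H]%classic); last first.
    by apply/seteqP; split=> [t []//|t tI]; split=> //=; rewrite ltry.
  case/andP: T1H xH => T10 T1H /andP[x0 xH].
  by rewrite /= lebesgue_measure_itv/= lte_fin T1H -EFinD lte_fin.
have U : ((u - f H)%:E < backlog f H)%E <-> (u%:E < (f H)%:E + backlog f H)%E.
  by rewrite EFinB lteBlDl.
have U0 : (u%:E < backlog f 0)%E <-> ((u - f H)%:E < backlog f H)%E.
  split.
    move/lt_backlog => [s s0]; rewrite f0 subr0 => us; apply/lt_backlog.
    case: (lerP H s) => Hs; first by exists s; rewrite ?ltrD2r.
    by exfalso; apply: nu; exists s => //; rewrite s0 ltW.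
  move/lt_backlog => [s Hs]; rewrite ltrD2r => us; apply/lt_backlog.
  by exists s; [rewrite (le_trans (ltW H0))|rewrite f0 subr0].
have M : ((Num.max u (y - z) - f H)%:E < backlog f H)%E <->
   ((u - f H)%:E < backlog f H)%E /\ ((y - z - f H)%:E < backlog f H)%E.
  rewrite EFinB lteBlDl// EFin_max gt_max.
  by rewrite !EFinB; split=> [/andP[]|[]]; rewrite !lteBlDl// => -> ->.
rewrite M U0; split=> -[h1 h2]; split=> //.
  exact: ((K (U.1 h2)).1 h1).
exact: ((K (U.1 h1)).2 h2).
Qed.

End backlog.


Lemma measurable_fun_ereal_rays d (T : measurableType d) (R : realType)
    (f : T -> \bar R) : (forall v : R, measurable [set o | (v%:E < f o)%E]) ->
  measurable_fun setT f.
Proof.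
move=> mf; apply: (measurability _ (ErealGenOInfty.measurableE R)) => // _ [_ [v ->] <-].
rewrite setTI (_ : _ @^-1` _ = [set o | (v%:E < f o)%E])//.
by apply/seteqP; split=> o /=; rewrite in_itv/= andbT.
Qed.

Section occupation_level.
Context {R : realType}.
Variables (T1 H x : R).
Hypotheses (T1H : 0 <= T1 < H) (xH : 0 <= x < H - T1).

Let H0 : 0 < H. Proof. by case/andP : T1H => ?; exact: le_lt_trans. Qed.

(** The level z of [long_occupation_level] for -f.  The supremum is taken in
    the extended reals, which makes it measurable on the space of all paths;
    [fine] loses information on discontinuous ones only. *)
Definition occupation_level (f : R -> R) : R :=
  fine (ereal_sup [set y%:E | y in
    [set y | long_occupation T1 H x y (fun t => (- f t)%:E)]]).

Let lt_sup (f : R -> R) (v : R) :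
  (v%:E < ereal_sup [set y%:E | y in
    [set y | long_occupation T1 H x y (fun t => (- f t)%:E)]])%E <->
  long_occupation T1 H x v (fun t => (- f t)%:E).
Proof.
split.
  move=> /ereal_sup_gtP[_ [y Ky <-]]; rewrite lte_fin => vy.
  by apply: long_occupation_mono Ky; exact: ltW.
move=> /long_occupation_open[y vy Ky]; apply/ereal_sup_gtP.
by exists y%:E; [exists y|rewrite lte_fin].
Qed.

Lemma occupation_levelP f y : continuous f ->
  long_occupation T1 H x y (fun t => (- f t)%:E) <-> y < occupation_level f.
Proof.
move=> cf; have cN : continuous (fun t => - f t) by move=> t; apply: cvgN; exact: cf.
have [z zP] := long_occupation_level T1H xH cN.
rewrite zP /occupation_level; set s := ereal_sup _.
have -> : s = z%:E by apply: eq_ereal_lt => v; rewrite lt_sup zP lte_fin.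
by [].
Qed.

Lemma measurable_occupation_level :
  measurable_fun setT (occupation_level : g_sigma_algebraType (cylinders H) -> R).
Proof.
apply: measurableT_comp => //; apply: measurable_fun_ereal_rays => v.
rewrite (_ : [set _ | _] = [set f | long_occupation T1 H x v (fun t => (- f t)%:E)]).
  apply: (measurable_long_occupation (e := fun t (f : g_sigma_algebraType (cylinders H)) => (- f t)%:E)) => //.
  move=> m i im; apply/measurable_EFinP; apply: measurableT_comp => //.
  exact: measurable_dyadic_coordinate.
by apply/seteqP; split=> f /lt_sup.
Qed.

End occupation_level.

Section backlog_independence.
Context (R : realType) (d : measure_display) (T : measurableType d).
Context (P : probability T R) (B : R -> {RV P >-> R}) (c H : R).
Hypotheses (hB : two_sided_brownian_motion B) (c0 : 0 < c) (H0 : 0 < H).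
Local Notation X := (drifted B c).

Let mX t : measurable_fun setT (X t). Proof. exact: measurable_drifted. Qed.
Let cX o : continuous (X ^~ o). Proof. exact: continuous_drifted. Qed.
Let future t s o := X (t + s) o - X t o.
Let mF t s : measurable_fun setT (future t s).
Proof. by apply: measurable_funB; exact: mX. Qed.
Let cF t o : continuous (future t ^~ o).
Proof.
move=> s; apply: cvgB; last exact: cvg_cst.
apply: (continuous_comp (f := fun s => t + s) (g := X ^~ o)); last exact: cX.
by apply: cvgD; [exact: cvg_cst|exact: cvg_id].
Qed.

Let lt_backlog_future t v : [set o | (v%:E < backlog (X ^~ o) t)%E] =
  [set o | ever_exceeds v (future t ^~ o)].
Proof.
apply/seteqP; split=> o /=.
  move/lt_backlog => [s ts vs]; exists (s - t); first by rewrite subr_ge0.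
  by rewrite /future subrKC.
move=> [s s0 vs]; apply/lt_backlog; exists (t + s) => //; by rewrite lerDl.
Qed.

Lemma measurable_backlog t : measurable_fun setT (fun o => backlog (X ^~ o) t).
Proof.
apply: measurable_fun_ereal_rays => v; rewrite lt_backlog_future.
exact: (@measurable_ever_exceeds R _ _ (future t) v (mF t) (@cF t)).
Qed.

Lemma drifted_tail_law v :
  P [set o | ever_exceeds v (X ^~ o)] = (expR (- (2 * c * Num.max 0 v)))%:E.
Proof.
case: (lerP 0 v) => v0; first exact: ever_exceeds_probability.
rewrite mulr0 oppr0 expR0 (_ : [set o | _] = setT) ?probability_setT//.
apply/seteqP; split=> // o _; exists 0 => //.
by rewrite (drifted0 c hB).
Qed.

(** The backlog at H is the maximum of the increments after H, which are
    independent of the past and distributed as X. *)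
Lemma backlog_independent (C : set (R -> R)) v : <<s cylinders H >> C ->
  P ([set o | C (X ^~ o)] `&` [set o | (v%:E < backlog (X ^~ o) H)%E]) =
  (P [set o | C (X ^~ o)] * (expR (- (2 * c * Num.max 0 v)))%:E)%E.
Proof.
move=> sC; set A := [set o | C _].
have mA : measurable A.
  apply: (@measurable_preimage_sigma _ _ _ (cylinders H) (fun o => X ^~ o)) => //.
  move=> C' /cylinder_increments[m [D sD CD]].
  rewrite (_ : _ @^-1` _ = [set o | D (dyadic_increments H m (X ^~ o))]).
    by apply: (measurable_grid_event _ sD) => i; exact: measurable_funB.
  by apply/seteqP; split=> o /=; move/(CD _ (drifted0 c hB o)).
have PA : (fine (P A))%:E = P A.
  rewrite fineK// ge0_fin_numE//.
  by rewrite (le_lt_trans (probability_le1 _ _)) ?ltry.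
have Pge0 : 0 <= fine (P A) by apply: fine_ge0; exact: measure_ge0.
rewrite lt_backlog_future -drifted_tail_law -PA setIC.
apply: (@ever_exceeds_law_unique R _ _ _ _ (mrestr P mA) (mscale (NngNum Pge0) P)
  (future H) X v (mF H) mX (@cF H) cX).
move=> H' m H'0.
pose D := [set a : nat -> R | exists2 k, (k <= 2 ^ m)%N & v < \sum_(j < k) a j].
have sD : <<s rectangles (2 ^ m) >> D.
  suff : @measurable _ (g_sigma_algebraType (@rectangles R (2 ^ m))) D by [].
  rewrite (_ : D = \bigcup_(k in `I_(2 ^ m).+1)
    ((fun a : nat -> R => \sum_(j < k) a j) @^-1` `]v, +oo[%classic)).
    apply: fin_bigcup_measurable => // k /= km.
    by rewrite -[X in measurable X]setTI; exact: measurable_partial_sum.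
  by apply/seteqP; split=> a [k km h]; exists k => //; move: h; rewrite /= in_itv/= andbT.
have d0 : 0 < H' / 2 ^+ m by rewrite divr_gt0// exprn_gt0.
have dE i : dyadic H' m i = H' / 2 ^+ m * i%:R by rewrite /dyadic mulrA mulrAC.
have E1 : [set o | grid_exceeds H' m v (future H ^~ o)] =
    [set o | D (increment B c (fun i => H + H' / 2 ^+ m * i%:R) ^~ o)].
  by apply/seteqP; split=> o [k km h]; exists k => //; move: h;
    rewrite sum_increment /future dE mulr0 addr0.
have E2 : [set o | grid_exceeds H' m v (X ^~ o)] =
    [set o | D (increment B c (fun i => H' / 2 ^+ m * i%:R) ^~ o)].
  by apply/seteqP; split=> o [k km h]; exists k => //; move: h;
    rewrite sum_increment dE mulr0 (drifted0 c hB) subr0.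
transitivity (P (A `&` [set o | grid_exceeds H' m v (future H ^~ o)])).
  by rewrite setIC.
transitivity (P A * P [set o | grid_exceeds H' m v (X ^~ o)])%E; last by rewrite -[in LHS]PA.
rewrite E1 E2 -(grid_stationary c hB H d0 sD).
exact: (path_future_independent c hB H0 d0 sC sD).
Qed.

End backlog_independence.


Section backlog_against_the_past.
Context (R : realType) (d : measure_display) (T : measurableType d).
Context (P : probability T R) (B : R -> {RV P >-> R}) (c H : R).
Hypotheses (hB : two_sided_brownian_motion B) (c0 : 0 < c) (H0 : 0 < H).
Local Notation X := (drifted B c).
Local Notation E := (fun o => backlog (X ^~ o) H).

Lemma measurable_path :
  measurable_fun setT (fun o => X ^~ o : g_sigma_algebraType (cylinders H)).
Proof.
move=> _ C sC; rewrite setTI.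
apply: (@measurable_preimage_sigma _ _ _ (cylinders H) (fun o => X ^~ o)) => //.
move=> C' /cylinder_increments[m [D sD CD]].
rewrite (_ : _ @^-1` _ = [set o | D (dyadic_increments H m (X ^~ o))]).
  apply: (measurable_grid_event _ sD) => i.
  by apply: measurable_funB; exact: measurable_drifted.
by apply/seteqP; split=> o /=; move/(CD _ (drifted0 c hB o)).
Qed.

Variable theta : (R -> R) -> R.
Hypothesis mtheta :
  measurable_fun setT (theta : g_sigma_algebraType (cylinders H) -> R).

Let Theta o := theta (X ^~ o).
Let mTheta : measurable_fun setT Theta.
Proof. exact: (measurableT_comp mtheta measurable_path). Qed.
Let mE : measurable_fun setT E. Proof. exact: measurable_backlog. Qed.

(** The half-lines generate the Borel sets, and for them the rule is
    [backlog_independent]. *)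
Let product_rule (A : set R) (D : set (\bar R)) : measurable A -> measurable D ->
  P (Theta @^-1` A `&` E @^-1` D) = (P (Theta @^-1` A) * P (E @^-1` D))%E.
Proof.
move=> mA mD; set TA := Theta @^-1` A.
have mTA : measurable TA by rewrite -[X in measurable X]setTI; exact: mTheta.
have PA : (fine (P TA))%:E = P TA.
  rewrite fineK// ge0_fin_numE//.
  by rewrite (le_lt_trans (probability_le1 _ _)) ?ltry.
have Pge0 : 0 <= fine (P TA) by apply: fine_ge0; exact: measure_ge0.
have sA : <<s cylinders H >> (theta @^-1` A).
  have := mtheta measurableT mA; rewrite setTI; exact.
pose rays : set (set (\bar R)) := @ErealGenOInfty.G R.
have rayE C : rays C -> exists2 v : R, C = `]v%:E, +oo[%classic &
    E @^-1` C = [set o | (v%:E < E o)%E].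
  move=> [v ->]; exists v => //.
  by apply/seteqP; split=> o /=; rewrite in_itv/= andbT.
have mray C : rays C -> measurable (E @^-1` C).
  move=> [v ->]; rewrite -[X in measurable X]setTI; apply: mE => //.
  exact: emeasurable_itv.
have indep v : P (TA `&` [set o | (v%:E < E o)%E]) =
    (P TA * P [set o | (v%:E < E o)%E])%E.
  have sT : <<s cylinders H >> setT by exact: sigma_setT.
  have h1 := backlog_independent hB c0 H0 v sA.
  have h2 := backlog_independent hB c0 H0 v sT.
  rewrite (_ : [set o | setT _] = setT)// setTI probability_setT mul1e in h2.
  by rewrite [X in _ = (_ * X)%E]h2 -h1.
rewrite -PA setIC.
apply: (@law_unique _ _ _ _ _ _ rays (mrestr P mTA) (mscale (NngNum Pge0) P) E E) => //.
- move=> _ _ [u ->] [v ->]; exists (Num.max u v).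
  apply/seteqP; split=> z /=; rewrite !in_itv/= !andbT EFin_max gt_max.
    by move=> [-> ->].
  by move/andP.
- transitivity (P (setT `&` TA)) => //.
  transitivity (P TA * P setT)%E; last by rewrite -[in LHS]PA.
  by rewrite setTI probability_setT mule1.
- apply: (le_lt_trans (probability_le1 P (measurableI _ _ measurableT mTA))).
  exact: ltry.
- move=> C /rayE[v _ ->].
  transitivity (P (TA `&` [set o | (v%:E < E o)%E])); first by rewrite setIC.
  by rewrite indep -[in LHS]PA.
- by have : emeasurable (@ocitv R) D := mD; rewrite ErealGenOInfty.measurableE.
Qed.

(** Fubini for the law of the pair (theta, E): given the past, E exceeds theta
    with the exponential tail probability. *)
Lemma probability_backlog_gt :
  P [set o | ((theta (X ^~ o))%:E < E o)%E] =
  (\int[P]_o (expR (- (2 * c * Num.max 0 (theta (X ^~ o)))))%:E)%E.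
Proof.
pose Th : {RV P >-> R} := mfun_Sub (mem_set mTheta).
pose Ev : {RV P >-> \bar R} := mfun_Sub (mem_set mE).
have mp : measurable_fun setT (fun o => (Theta o, E o)).
  exact: measurable_fun_pair.
pose Pr : {RV P >-> (R * \bar R)%type} := mfun_Sub (mem_set mp).
pose D : set (R * \bar R) := [set z | (z.1%:E < z.2)%E].
have mD : measurable D.
  rewrite -[D]setTI; apply: measurable_lte => //.
  by apply/measurable_EFinP; exact: measurable_fst.
have uniq : ((distribution P Th \x distribution P Ev) D = distribution P Pr D)%E.
  apply: product_measure_unique; last exact: mD.
  by move=> A C mA mC; exact: (product_rule mA mC).
transitivity (distribution P Pr D) => //; rewrite -uniq.
rewrite /product_measure1 /=.
pose G (a : R) := (expR (- (2 * c * Num.max 0 a)))%:E.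
have mG : measurable_fun setT G.
  apply/measurable_EFinP; apply: measurableT_comp => //; apply: measurableT_comp => //.
  by apply: measurable_funM => //; exact: measurable_maxr.
transitivity (\int[distribution P Th]_a G a)%E.
  apply: eq_integral => a _; rewrite /= /distribution /pushforward.
  have h2 := backlog_independent hB c0 H0 a (@sigma_setT _ _).
  rewrite (_ : [set o | setT _] = setT)// setTI probability_setT mul1e in h2.
  rewrite -[RHS]h2; congr (P _); apply/seteqP; split=> o /=.
    by rewrite /xsection /= inE.
  by rewrite /xsection /= inE.
rewrite ge0_integral_distribution//.
by move=> a; rewrite lee_fin expR_ge0.
Qed.

End backlog_against_the_past.


(** * The limit constant *)
Section exponential_integrals.
Context {R : realType}.
Local Notation mu := lebesgue_measure.

Let measurable_exp (r : R) (D : set R) :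
  measurable_fun D (fun y : R => (expR (r * y))%:E).
Proof.
by apply/measurable_EFinP/measurable_funTS; apply: measurableT_comp => //.
Qed.

Lemma integral_exp_below (r a : R) : 0 < r ->
  (\int[mu]_(y in `]-oo, a]) (expR (r * y)%R)%:E = (expR (r * a) / r)%:E)%E.
Proof.
move=> r0; rewrite integral_mkcond.
have mf : measurable_fun setT ((fun y : R => (expR (r * y))%:E) \_ `]-oo, a]).
  by apply/(measurable_restrictT _ _).1 => //; exact: measurable_exp.
rewrite -(integral_reflect a mf); last first.
  by move=> y; rewrite patchE; case: ifP => // _; rewrite lee_fin expR_ge0.
rewrite -[RHS]mule1 -(integral_exponential_pdf r0) -ge0_integralZl//; last 3 first.
- by apply/measurable_EFinP; exact: measurable_exponential_pdf.
- by move=> y _; rewrite lee_fin exponential_pdf_ge0// ltW.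
- by rewrite lee_fin divr_ge0 ?expR_ge0// ltW.
apply: eq_integral => z _; rewrite patchE.
have -> : (a - z \in `]-oo, a]%classic) = (0 <= z).
  by apply/idP/idP; rewrite inE/= in_itv/= => ?; lra.
case: ifPn => z0; last by rewrite lt0_exponential_pdf ?mule0// ltNge.
rewrite exponential_pdfE// /exponential_pdf -EFinM; congr EFin.
rewrite mulrA divfK ?gt_eqF// -expRD; congr expR; ring.
Qed.

Lemma integral_exp_below_lt (r v z : R) : 0 < r ->
  (\int[mu]_(y in `]-oo, v]) ((expR (r * y)%R)%:E * (\1_[set y | (y < z)%R] y)%:E) =
   (expR (r * Num.min v z) / r)%:E)%E.
Proof.
move=> r0.
transitivity (\int[mu]_(y in `]-oo, v] `&` [set y | (y < z)%R]) (expR (r * y)%R)%:E)%E.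
  by rewrite [RHS]integral_mkcondr; apply: eq_integral => y _; rewrite epatch_indic.
case: (ltP v z) => vz.
  rewrite (_ : _ `&` _ = `]-oo, v]%classic) ?integral_exp_below//.
  by apply/seteqP; split=> [y []//|y]; rewrite /= !in_itv/= => yv; split=> //; exact: le_lt_trans vz.
rewrite (_ : _ `&` _ = `]-oo, z[%classic).
  by rewrite integral_itv_bndo_bndc ?integral_exp_below//; exact: measurable_exp.
by apply/seteqP; split=> [y []//|y]; rewrite /= !in_itv/= => yz; split=> //; rewrite ltW// (lt_le_trans yz).
Qed.

End exponential_integrals.

Section limit_constant.
Context (R : realType) (d : measure_display) (T : measurableType d).
Context (P : probability T R) (B : R -> {RV P >-> R}) (c T1 H x : R).
Hypotheses (hB : two_sided_brownian_motion B) (c0 : 0 < c).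
Hypotheses (T1H : 0 <= T1 < H) (xH : 0 <= x < H - T1).
Local Notation X := (drifted B c).
Local Notation w := (girsanov_weight B c H).
Local Notation Z := (fun o => occupation_level T1 H x (X ^~ o)).

Let H0 : 0 < H. Proof. by case/andP : T1H => ?; exact: le_lt_trans. Qed.
Let cX o : continuous (X ^~ o). Proof. exact: continuous_drifted. Qed.

(** The limit before the change of measure; [limit_integralE] expresses it
    through the constant of the statement. *)
Definition limit_integral (v : R) : \bar R :=
  (\int[P]_o (w o * expR (- (2 * c * Num.max 0 (v - Z o))))%R%:E)%E.

Lemma measurable_level : measurable_fun setT Z.
Proof.
have mp := @measurable_path R d T P B c H hB.
by apply: (measurableT_comp _ mp); exact: measurable_occupation_level.
Qed.

Let mw : measurable_fun setT w. Proof. exact: measurable_girsanov_weight. Qed.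
Let w0 o : 0 <= w o. Proof. exact: girsanov_weight_ge0. Qed.

Let mwexp v : measurable_fun setT (fun o => w o * expR (- (2 * c * Num.max 0 (v - Z o)))).
Proof.
apply: measurable_funM => //; apply: measurableT_comp => //; apply: measurableT_comp => //.
apply: measurable_funM => //; apply: measurable_maxr => //.
by apply: measurable_funB => //; exact: measurable_level.
Qed.

Lemma integral_girsanov_weight : (\int[P]_o (w o)%:E = 1)%E.
Proof.
have := path_girsanov c hB H0 (@sigma_setT _ (cylinders H)).
by rewrite -(@probability_setT _ _ _ P).
Qed.

Lemma limit_integral_ge0 v : (0 <= limit_integral v)%E.
Proof. by apply: integral_ge0 => o _; rewrite lee_fin mulr_ge0// expR_ge0. Qed.

Lemma limit_integral_le1 v : (limit_integral v <= 1)%E.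
Proof.
rewrite -integral_girsanov_weight; apply: ge0_le_integral => //.
- by move=> o _; rewrite lee_fin mulr_ge0// expR_ge0.
- exact/measurable_EFinP.
- exact/measurable_EFinP.
- move=> o _; rewrite lee_fin ler_piMr// -expR0 ler_expR oppr_le0.
  by rewrite !mulr_ge0 ?le_max ?lexx// ltW.
Qed.

Lemma limit_integral_fin v : limit_integral v \is a fin_num.
Proof.
by rewrite ge0_fin_numE ?limit_integral_ge0// (le_lt_trans (limit_integral_le1 v)) ?ltry.
Qed.

Lemma limit_integral_gt0 v : (0 < limit_integral v)%E.
Proof.
rewrite lt_neqAle limit_integral_ge0 andbT eq_sym; apply/negP => /eqP E.
have mf : measurable_fun setT (fun o => (w o * expR (- (2 * c * Num.max 0 (v - Z o))))%:E).
  exact/measurable_EFinP.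
have : (\int[P]_o `|(w o * expR (- (2 * c * Num.max 0 (v - Z o))))%:E| = 0)%E.
  rewrite -[RHS]E; apply: eq_integral => o _.
  by rewrite gee0_abs// lee_fin mulr_ge0// expR_ge0.
move/(ae_eq_integral_abs P measurableT mf) => [N [mN N0 sub]].
have NT : N = setT.
  apply/seteqP; split=> // o _; apply: sub => /= /(_ Logic.I)/eqP.
  by rewrite eqe mulf_eq0 !gt_eqF ?expR_gt0.
rewrite NT in N0; have [] := etrans (esym (@probability_setT _ _ _ P)) N0.
by move/eqP; rewrite oner_eq0.
Qed.

Lemma limit_integral_lipschitz v v' :
  (limit_integral v <= (expR (2 * c * `|v - v'|))%:E * limit_integral v')%E.
Proof.
rewrite -ge0_integralZl//; last 2 first.
- exact/measurable_EFinP.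
- by move=> o _; rewrite lee_fin mulr_ge0// expR_ge0.
apply: ge0_le_integral => //.
- by move=> o _; rewrite lee_fin mulr_ge0// expR_ge0.
- exact/measurable_EFinP.
- by apply: emeasurable_funM => //; exact/measurable_EFinP.
move=> o _; rewrite -EFinM lee_fin mulrCA ler_wpM2l// -expRD ler_expR.
rewrite -mulrN -mulrN -mulrDr ler_pM2l ?mulr_gt0//.
have h := ler_norm (v' - v); rewrite distrC in h.
have h2 := ler_norm (v - v').
rewrite /Num.max; case: ifPn => h3; case: ifPn => h4; rewrite -?leNgt in h3 h4; lra.
Qed.

(** Under the weight, the occupation time of -X above y has the law of the
    occupation time of X above y. *)
Lemma probability_long_occupation y :
  (\int[P]_(o in [set o | (y < Z o)%R]) (w o)%:E)%E =
  P [set o | (x%:E < occupation_time T1 H (fun t => (B t o - c * t)%R%:E) y)%E].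
Proof.
pose C := [set f : R -> R | long_occupation T1 H x y (fun t => (f t)%:E)].
have sC : <<s cylinders H >> C.
  suff : @measurable _ (g_sigma_algebraType (cylinders H)) C by [].
  apply: (measurable_long_occupation (e := fun t (f : g_sigma_algebraType (cylinders H)) => (f t)%:E)) => //.
  by move=> m i im; apply/measurable_EFinP; exact: measurable_dyadic_coordinate.
rewrite (_ : [set o | _] = [set o | C (fun t => - X t o)]); last first.
  by apply/seteqP; split=> o; rewrite /C /= => /(occupation_levelP T1H xH _ (@cX o)).
rewrite (path_girsanov c hB H0 sC); congr (P _).
have cXE o : {within `[T1, H], continuous (fun t => (X t o)%:E)}.
  apply: continuous_subspaceT => t; apply: cvg_comp; first exact: (@cX o).
  by [].
by apply/seteqP; split=> o; rewrite /C /= => /(long_occupationP x y T1H (cXE o)).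
Qed.

(** Layer-cake formula: exp (-2 c max (0, v - Z)) is the integral of
    2 c exp (2 c (y - v)) over the levels y <= v with y < Z.  Tonelli's theorem
    moves the expectation inside, where [probability_long_occupation]
    applies. *)
Lemma limit_integralE v :
  limit_integral v = (expR (- (2 * c * v)) * calC B c T1 H x v)%:E.
Proof.
have r0 : 0 < 2 * c by rewrite mulr_gt0.
pose F (z : T * R) : \bar R := ((w z.1)%:E *
  ((expR (2 * c * z.2))%:E * (\1_`]-oo, v] z.2)%:E) *
  (\1_[set z : T * R | z.2 < Z z.1] z)%:E)%E.
have mlt : measurable [set z : T * R | z.2 < Z z.1].
  rewrite (_ : [set _ | _] = setT `&` [set z : T * R | (z.2%:E < (Z z.1)%:E)%E]).
    apply: measurable_lte => //; apply/measurable_EFinP; first exact: measurable_snd.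
    by apply: (measurableT_comp measurable_level); exact: measurable_fst.
  by rewrite setTI.
have mF : measurable_fun setT F.
  apply: emeasurable_funM; last exact/measurable_EFinP/measurable_indic.
  apply: emeasurable_funM.
    by apply/measurable_EFinP; apply: (measurableT_comp mw); exact: measurable_fst.
  apply: emeasurable_funM; apply/measurable_EFinP.
    apply: measurableT_comp => //; apply: measurable_funM => //; exact: measurable_snd.
  by apply: measurableT_comp => //; exact: measurable_snd.
have F0 z : (0 <= F z)%E by rewrite /F !mule_ge0// lee_fin ?expR_ge0.
have inner o : (\int[lebesgue_measure]_y F (o, y) =
    (w o * (expR (2 * c * Num.min v (Z o)) / (2 * c)))%:E)%E.
  rewrite EFinM -integral_exp_below_lt// [in RHS]integral_mkcond -ge0_integralZl//.
  - apply: eq_integral => y _; rewrite /F/= -muleA; congr (_ * _)%E.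
    rewrite patchE indicE; case: ifPn => yv; rewrite ?mule1 ?mule0 ?mul0e//.
  - apply/(measurable_restrictT _ _).1 => //; apply: measurable_funTS.
    apply: emeasurable_funM; apply/measurable_EFinP.
      by apply: measurableT_comp => //; exact: measurable_funM.
    apply: measurable_indic; rewrite (_ : [set y | _] = `]-oo, (Z o)[%classic)//.
  - move=> y _; rewrite patchE; case: ifP => // _; rewrite mule_ge0// lee_fin.
    exact: expR_ge0.
pose p y := P [set o | (x%:E < occupation_time T1 H (fun t => (B t o - c * t)%R%:E) y)%E].
have outer y : (\int[P]_o F (o, y) =
    ((expR (2 * c * y))%:E * (\1_`]-oo, v] y)%:E) * p y)%E.
  rewrite /p -probability_long_occupation [in RHS]integral_mkcond -ge0_integralZl//.
  - apply: eq_integral => o _; rewrite /F/= epatch_indic muleAC muleC.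
    by congr (_ * _)%E; rewrite muleC.
  - apply/(measurable_restrictT _ _).1 => //.
      have := measurable_level measurableT (measurable_itv `]y, +oo[).
      rewrite setTI (_ : _ @^-1` _ = [set o | y < Z o])//.
      by apply/seteqP; split=> o; rewrite /= in_itv/= andbT.
    by apply: measurable_funTS; exact/measurable_EFinP.
  - by move=> o _; rewrite patchE; case: ifP => // _; rewrite lee_fin.
have Fub : (\int[P]_o \int[lebesgue_measure]_y F (o, y) =
    \int[lebesgue_measure]_y \int[P]_o F (o, y))%E.
  exact: (@fubini_tonelli _ _ T (measurableTypeR R)).
pose J := (\int[lebesgue_measure]_(y in `]-oo, v]) ((expR (2 * c * y)%R)%:E * p y))%E.
have JE : (\int[lebesgue_measure]_y \int[P]_o F (o, y) = J)%E.
  rewrite /J [RHS]integral_mkcond; apply: eq_integral => y _.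
  by rewrite outer epatch_indic muleAC.
have k0 : 0 <= 2 * c * expR (- (2 * c * v)) by rewrite mulr_ge0 ?expR_ge0// ltW.
have LE : limit_integral v = ((2 * c * expR (- (2 * c * v)))%:E * J)%E.
  rewrite -JE -Fub -ge0_integralZl//; last 2 first.
  - exact: (@measurable_fun_fubini_tonelli_F _ _ T (measurableTypeR R) R lebesgue_measure F).
  - by move=> o _; exact: integral_ge0.
  apply: eq_integral => o _; rewrite inner -EFinM; congr EFin.
  rewrite mulrCA; congr (_ * _); set a := expR (- (2 * c * v)); set b := expR (2 * c * Num.min _ _).
  have -> : 2 * c * a * (b / (2 * c)) = a * b by field; rewrite gt_eqF.
  rewrite /a /b -expRD; congr expR; rewrite /Num.max /Num.min.
  by case: ifPn => h1; case: ifPn => h2; rewrite -?leNgt in h1 h2; nra.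
have J0 : (0 <= J)%E.
  by apply: integral_ge0 => y _; rewrite mule_ge0 ?lee_fin ?expR_ge0 ?measure_ge0.
have Jfin : J \is a fin_num.
  rewrite ge0_fin_numE// ltNge leye_eq; apply/negP => /eqP Joo.
  have := limit_integral_fin v; rewrite LE Joo mulry gtr0_sg ?mul1e//.
  by rewrite mulr_gt0 ?expR_gt0.
rewrite LE /calC -(fineK Jfin) -EFinM; congr EFin.
by rewrite mulrCA mulrA.
Qed.

End limit_constant.


(** * Estimates at a high level *)
Section descent_probability.
Context (R : realType) (d : measure_display) (T : measurableType d).
Context (P : probability T R) (B : R -> {RV P >-> R}) (c H : R).
Hypotheses (hB : two_sided_brownian_motion B) (H0 : 0 < H).
Local Notation X := (drifted B c).

Let mN t : measurable_fun setT (fun o => - X t o).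
Proof. by apply: measurableT_comp => //; exact: measurable_drifted. Qed.
Let cN o : continuous (fun t => - X t o).
Proof. by move=> t; apply: cvgN; exact: continuous_drifted. Qed.

(** The common size, relative to exp (- 2 c u), of all the error terms. *)
Definition descent_probability (u : R) : \bar R :=
  P [set o | exceeds H u (fun t => - X t o)].
Local Notation rho := descent_probability.

Lemma measurable_descent u : measurable [set o | exceeds H u (fun t => - X t o)].
Proof. exact: (@measurable_exceeds R _ _ (fun t o => - X t o) u mN cN _ H0). Qed.

Lemma descent_probability_ge0 u : (0 <= rho u)%E.
Proof. exact: (@measure_ge0 _ _ _ P). Qed.

Lemma descent_probability_fin u : rho u \is a fin_num.
Proof.
rewrite ge0_fin_numE ?descent_probability_ge0//.
by rewrite (le_lt_trans (probability_le1 _ _)) ?ltry//; exact: measurable_descent.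
Qed.

(** A continuous path is bounded on [0, H]. *)
Lemma descent_probability_small (e : R) : 0 < e ->
  exists M, forall u, M <= u -> (rho u <= e%:E)%E.
Proof.
move=> e0; pose F n := [set o | exceeds H n%:R (fun t => - X t o)].
have capF : \bigcap_n F n = set0.
  apply/seteqP; split=> // o Fo.
  have cW : {within `[0, H], continuous (fun t => - X t o)}.
    by apply: continuous_subspaceT; exact: cN.
  have [tm tmI tmP] := EVT_max (ltW H0) cW.
  have [t tH] := Fo (Num.truncn (- X tm o)).+1 Logic.I.
  apply/negP; rewrite -leNgt (le_trans (tmP t _))//.
  by apply/ltW/truncnS_gt.
have cF : P (F n) @[n --> \oo] --> P (\bigcap_n F n).
  apply: nonincreasing_cvg_mu.
  - by rewrite (le_lt_trans (probability_le1 _ _)) ?ltry//; exact: measurable_descent.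
  - by move=> n; exact: measurable_descent.
  - by apply: bigcapT_measurable => n; exact: measurable_descent.
  - move=> m n mn; apply/subsetPset => o [t tH nt]; exists t => //.
    by rewrite (le_lt_trans _ nt)// ler_nat.
rewrite capF measure0 in cF.
have [n hn] : exists n, (P (F n) <= e%:E)%E.
  apply: contrapT => /forallNP h.
  have : (e%:E <= 0)%E.
    apply: (cvge_ge _ cF); apply: nearW => n.
    by rewrite leNgt; apply/negP => /ltW /h.
  by rewrite lee_fin leNgt e0.
exists n%:R => u nu; apply: le_trans hn; apply: le_measure; rewrite ?inE.
- exact: measurable_descent.
- exact: measurable_descent.
- by move=> o [t tH ut]; exists t => //; exact: le_lt_trans ut.
Qed.

End descent_probability.

Section high_level_estimates.
Context (R : realType) (d : measure_display) (T : measurableType d).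
Context (P : probability T R) (B : R -> {RV P >-> R}) (c T1 H x : R).
Hypotheses (hB : two_sided_brownian_motion B) (c0 : 0 < c).
Hypotheses (T1H : 0 <= T1 < H) (xH : 0 <= x < H - T1).
Local Notation X := (drifted B c).
Local Notation w := (girsanov_weight B c H).
Local Notation Z := (fun o => occupation_level T1 H x (X ^~ o)).
Local Notation L := (limit_integral B c T1 H x).

Let H0 : 0 < H. Proof. by case/andP : T1H => ?; exact: le_lt_trans. Qed.
Let cX o : continuous (X ^~ o). Proof. exact: continuous_drifted. Qed.
Let mX t : measurable_fun setT (X t). Proof. exact: measurable_drifted. Qed.
Let mN t : measurable_fun setT (fun o => - X t o).
Proof. exact: measurableT_comp. Qed.
Let mZ : measurable_fun setT Z. Proof. exact: measurable_level. Qed.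
Let mw : measurable_fun setT w. Proof. exact: measurable_girsanov_weight. Qed.
Let w0 o : 0 <= w o. Proof. exact: girsanov_weight_ge0. Qed.

Local Notation rho := (descent_probability B c H).

(** What E has to exceed in [long_occupation_backlog]. *)
Let threshold (u y : R) (f : R -> R) : R :=
  Num.max u (y - occupation_level T1 H x f) - f H.

Let measurable_threshold u y : measurable_fun setT
  (threshold u y : g_sigma_algebraType (cylinders H) -> R).
Proof.
apply: measurable_funB.
  apply: measurable_maxr => //; apply: measurable_funB => //.
  exact: measurable_occupation_level.
by have := @measurable_dyadic_coordinate R H 0 _ (leqnn (2 ^ 0)); rewrite dyadic_end.
Qed.

Let I u y := (\int[P]_o (expR (- (2 * c * Num.max 0 (threshold u y (X ^~ o)))))%:E)%E.

Let mI u y : measurable_fun setT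
  (fun o => (expR (- (2 * c * Num.max 0 (threshold u y (X ^~ o)))))%:E).
Proof.
apply/measurable_EFinP; apply: measurableT_comp => //; apply: measurableT_comp => //.
apply: measurable_funM => //; apply: measurable_maxr => //.
exact: (measurableT_comp (measurable_threshold u y) (@measurable_path R d T P B c H hB)).
Qed.

Let mL v : measurable_fun setT
  (fun o => (w o * expR (- (2 * c * Num.max 0 (v - Z o))))%:E).
Proof.
apply/measurable_EFinP.
apply: measurable_funM => //; apply: measurableT_comp => //; apply: measurableT_comp => //.
apply: measurable_funM => //; apply: measurable_maxr => //.
exact: measurable_funB.
Qed.

Let L0 v o : (0 <= (w o * expR (- (2 * c * Num.max 0 (v - Z o))))%:E)%E.
Proof. by rewrite lee_fin mulr_ge0// expR_ge0. Qed.

Let threshold_max (u y z : R) : Num.max u (y - z) = u + Num.max 0 (y - u - z).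
Proof. by rewrite addr_maxr addr0; congr Num.max; ring. Qed.

(** Dropping the positive part of the threshold in the exponent. *)
Let I_le u y : (I u y <= (expR (- (2 * c * u)))%:E * L (y - u))%E.
Proof.
rewrite /limit_integral -ge0_integralZl//.
apply: ge0_le_integral => //.
- exact: measurable_funeM.
move=> o _; rewrite -EFinM lee_fin /girsanov_weight -!expRD ler_expR /threshold.
rewrite -!mulrN -mulrDr -mulrDr ler_pM2l ?mulr_gt0//.
rewrite threshold_max; set a := Num.max 0 (y - u - _).
have : u + a - X H o <= Num.max 0 (u + a - X H o) by rewrite le_max lexx orbT.
by move=> ?; lra.
Qed.

(** By the change of measure the left-hand side is P (- X(H) > u). *)
Let integral_weight_high u :
  (\int[P]_(o in [set o | (u < X H o)%R]) (w o)%:E <= rho u)%E.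
Proof.
pose C := [set f : R -> R | u < - f H].
have sC : <<s cylinders H >> C.
  suff : @measurable _ (g_sigma_algebraType (cylinders H)) C by [].
  have mc : measurable_fun setT (fun f : g_sigma_algebraType (cylinders H) => - f H).
    apply: measurableT_comp => //.
    by have := @measurable_dyadic_coordinate R H 0 _ (leqnn (2 ^ 0)); rewrite dyadic_end.
  have := mc measurableT _ (measurable_itv `]u, +oo[); rewrite setTI.
  rewrite (_ : _ @^-1` _ = C)//.
  by apply/seteqP; split=> f; rewrite /C /= in_itv/= andbT.
have := path_girsanov c hB H0 sC.
rewrite (_ : [set o | C (fun t => - X t o)] = [set o | u < X H o]); last first.
  by apply/seteqP; split=> o; rewrite /C /= opprK.
move=> ->; apply: le_measure; rewrite ?inE.
- exact: (@measurable_above R _ _ (fun t o => - X t o) u mN H).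
- exact: measurable_descent.
- by move=> o uH; exists H => //; rewrite lexx ltW.
Qed.

(** The positive part of the threshold matters only if X(H) > u. *)
Let L_le u y : ((expR (- (2 * c * u)))%:E * L (y - u) <=
  I u y + (expR (- (2 * c * u)))%:E * rho u)%E.
Proof.
have mhigh : measurable [set o | u < X H o] by exact: (@measurable_above R _ _ X u mX H).
have mwE : measurable_fun setT (fun o => (w o)%:E) by exact/measurable_EFinP.
have wE0 o : (0 <= (w o)%:E)%E by rewrite lee_fin.
apply: (@le_trans _ _ (I u y + (expR (- (2 * c * u)))%:E *
  \int[P]_(o in [set o | (u < X H o)%R]) (w o)%:E)%E); last first.
  by rewrite leeD2l// lee_wpmul2l ?lee_fin ?expR_ge0.
rewrite [X in (_ + _ * X)%E]integral_mkcond.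
have mr : measurable_fun setT ((fun o => (w o)%:E) \_ [set o | u < X H o]).
  by apply/(measurable_restrictT _ _).1 => //; exact: measurable_funTS.
have r0 o : (0 <= ((fun o => (w o)%:E) \_ [set o | (u < X H o)%R]) o)%E.
  by rewrite patchE; case: ifP.
rewrite /limit_integral -!ge0_integralZl// /I -ge0_integralD//; last 2 first.
- by move=> o _; rewrite mule_ge0// lee_fin expR_ge0.
- exact: measurable_funeM.
apply: ge0_le_integral => //.
- by move=> o _; rewrite mule_ge0// lee_fin expR_ge0.
- exact: measurable_funeM.
- by apply: emeasurable_funD => //; exact: measurable_funeM.
move=> o _; rewrite patchE.
have E : expR (- (2 * c * u)) * (w o * expR (- (2 * c * Num.max 0 (y - u - Z o)))) =
    expR (- (2 * c * threshold u y (X ^~ o))).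
  rewrite /girsanov_weight -!expRD; congr expR; rewrite /threshold.
  rewrite -!mulrN -mulrDr -mulrDr; congr (_ * _).
  by rewrite threshold_max; ring.
rewrite -EFinM E.
case: ifPn => uX.
  rewrite -EFinM -EFinD lee_fin -E; apply: (@le_trans _ _ (expR (- (2 * c * u)) * w o)).
    rewrite ler_wpM2l ?expR_ge0// ler_piMr// -expR0 ler_expR oppr_le0.
    by rewrite !mulr_ge0 ?le_max ?lexx// ltW.
  by rewrite lerDr expR_ge0.
rewrite mule0 adde0 lee_fin ler_expR lerN2 ler_pM2l ?mulr_gt0//.
have {}uX : X H o <= u by rewrite leNgt; apply/negP => h; move/negP : uX; apply; rewrite inE.
rewrite ge_max lexx andbT /threshold subr_ge0.
by rewrite (le_trans uX)// le_max lexx.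
Qed.

Definition queue_event (u y : R) : set T :=
  [set o | long_occupation T1 H x y (backlog (X ^~ o)) /\
           (u%:E < backlog (X ^~ o) 0)%E].

Lemma measurable_queue_event u y : measurable (queue_event u y).
Proof.
apply: measurableI.
  apply: (measurable_long_occupation (e := fun t o => backlog (X ^~ o) t)) => //.
  by move=> m i _; exact: measurable_backlog.
have := measurable_backlog c hB 0 measurableT (emeasurable_itv `]u%:E, +oo[).
rewrite setTI (_ : _ @^-1` _ = [set o | (u%:E < backlog (X ^~ o) 0)%E])//.
by apply/seteqP; split=> o; rewrite /= in_itv/= andbT.
Qed.

(** The two events coincide when X stays below u on [0, H], and [exceeds_le]
    bounds the probability that it does not. *)
Let event_vs_threshold u y :
  let G := [set o | ((threshold u y (X ^~ o))%:E < backlog (X ^~ o) H)%E] in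
  (P (queue_event u y) <= P G + (expR (- (2 * c * u)))%:E * rho u)%E /\
  (P G <= P (queue_event u y) + (expR (- (2 * c * u)))%:E * rho u)%E.
Proof.
move=> G; have mQ := measurable_queue_event u y.
have mG : measurable G.
  rewrite -[G]setTI; apply: measurable_lte => //.
    apply/measurable_EFinP.
    exact: (measurableT_comp (measurable_threshold u y) (@measurable_path R d T P B c H hB)).
  exact: measurable_backlog.
pose S := [set o | exceeds H u (X ^~ o)].
have mS : measurable S by exact: (@measurable_exceeds R _ _ X u mX cX _ H0).
have QG o : ~ S o -> queue_event u y o <-> G o.
  move=> nS; apply: long_occupation_backlog => //; first exact: drifted0.
  by move=> y'; exact: (occupation_levelP T1H xH _ (@cX o)).
have le2 (A D : set T) : measurable A -> measurable D -> A `<=` D `|` S ->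
    (P A <= P D + (expR (- (2 * c * u)))%:E * rho u)%E.
  move=> mA mD ADS; apply: (@le_trans _ _ (P (D `|` S))).
    by apply: le_measure; rewrite ?inE//; exact: measurableU.
  apply: (@le_trans _ _ (P D + P S)%E); first exact: measureU2.
  by rewrite leeD2l//; exact: exceeds_le.
split; apply: le2 => // o; have [So|nS] := pselect (S o); do ?[by right];
  by move/(QG _ nS); left.
Qed.

Lemma queue_event_le u y :
  (P (queue_event u y) <= (expR (- (2 * c * u)))%:E * (L (y - u) + rho u))%E.
Proof.
have [h _] := event_vs_threshold u y; apply: le_trans h _.
rewrite (probability_backlog_gt hB c0 H0 (measurable_threshold u y)).
rewrite ge0_muleDr ?limit_integral_ge0//.
by apply: leeD => //; exact: I_le.
Qed.

Lemma queue_event_ge u y :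
  ((expR (- (2 * c * u)))%:E * L (y - u) <=
   P (queue_event u y) + (expR (- (2 * c * u)))%:E * (rho u + rho u))%E.
Proof.
have [_ h] := event_vs_threshold u y; apply: le_trans (L_le u y) _.
rewrite ge0_muleDr ?descent_probability_ge0// addeA leeD2r//; apply: le_trans h.
by rewrite (probability_backlog_gt hB c0 H0 (measurable_threshold u y)).
Qed.

End high_level_estimates.


(** * The conditional occupation time *)
Section workload_of_drifted_path.
Context (R : realType) (d : measure_display) (T : measurableType d).
Context (P : probability T R) (B : R -> {RV P >-> R}) (c : R).
Hypotheses (hB : two_sided_brownian_motion B) (c0 : 0 < c).
Local Notation X := (drifted B c).

Lemma workloadE t o : workload B c t o = backlog (X ^~ o) t.
Proof.
rewrite /workload /backlog; congr ereal_sup; apply/seteqP.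
by split=> _ [s ts <-]; exists s => //; congr EFin; rewrite /drifted; ring.
Qed.

Lemma probability_workload_gt u : 0 <= u ->
  P [set o | (u%:E < workload B c 0 o)%E] = (expR (- (2 * c * u)))%:E.
Proof.
move=> u0; rewrite -(ever_exceeds_probability hB c0 u0); congr (P _).
apply/seteqP; split=> o /=; rewrite workloadE.
  by move/lt_backlog => [s s0]; rewrite (drifted0 c hB) subr0; exists s.
by move=> [s s0 us]; apply/lt_backlog; exists s => //; rewrite (drifted0 c hB) subr0.
Qed.

End workload_of_drifted_path.

Lemma path_measurable_queue_event (R : realType) (T1 H x u y : R) : 0 < H ->
  path_measurable `[0, +oo[
    [set f : R -> \bar R | long_occupation T1 H x y f /\ (u%:E < f 0%R)%E].
Proof.
move=> H0; rewrite /path_measurable; set G := (X in <<s X >>).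
have coord t : 0 <= t ->
    measurable_fun setT (fun f : g_sigma_algebraType G => f t).
  move=> t0 _ A mA; rewrite setTI; apply: sub_sigma_algebra.
  by exists t, A; split=> //; rewrite /= in_itv/= t0.
suff : @measurable _ (g_sigma_algebraType G)
  [set f : R -> \bar R | long_occupation T1 H x y f /\ (u%:E < f 0%R)%E] by [].
apply: measurableI.
  apply: (measurable_long_occupation (e := fun t (f : g_sigma_algebraType G) => f t)) => //.
  move=> m i _; apply: coord.
  by rewrite -(dyadic0 H m) ler_dyadic.
have := coord 0 (lexx _) measurableT _ (emeasurable_itv `]u%:E, +oo[).
rewrite setTI (_ : _ @^-1` _ = [set f : R -> \bar R | (u%:E < f 0%R)%E])//.
by apply/seteqP; split=> f; rewrite /= in_itv/= andbT.
Qed.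

(** Here l and l' stand for the limit constant at w and at omega u - u, whose
    ratio is between 1 / a and a, and p for the conditional probability. *)
Lemma ratio_estimate (R : realFieldType) (a l l' p r e : R) :
  0 < e -> 0 < l -> 0 <= l' -> a <= 1 + e / 2 -> l' <= a * l -> l <= a * l' ->
  r <= e * l / 4 -> p <= l' + r -> l' <= p + (r + r) -> `|1 - p / l| <= e.
Proof.
move=> e0 l0 l'0 ae l1 l2 re up lo.
have -> : 1 - p / l = (l - p) / l by rewrite mulrBl divff ?gt_eqF.
rewrite normrM normfV (gtr0_norm l0) ler_pdivrMr// ler_norml.
have al : a * l <= (1 + e / 2) * l by rewrite ler_wpM2r// ltW.
have al' : a * l' <= (1 + e / 2) * l' by rewrite ler_wpM2r.
have ll' : (1 - e / 2) * l <= l'.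
  case: (lerP (e / 2) 1) => e21; last first.
    by apply: le_trans l'0; rewrite mulr_le0_ge0 ?ltW// subr_lt0.
  apply: (@le_trans _ _ ((1 - e / 2) * ((1 + e / 2) * l'))).
    by apply: ler_wpM2l; [rewrite subr_ge0|exact: le_trans l2 al'].
  rewrite mulrA; apply: ler_piMl l'0 _.
  have -> : (1 - e / 2) * (1 + e / 2) = 1 - e / 2 * (e / 2) by ring.
  by rewrite lerBlDr lerDl mulr_ge0// divr_ge0// ltW.
by apply/andP; split; lra.
Qed.

Theorem proposition2p1 (R : realType) (d d' : measure_display)
    (T : measurableType d) (T' : measurableType d')
    (P : probability T R) (P' : probability T' R)
    (B : R -> {RV P >-> R}) (Q : R -> {RV P' >-> \bar R})
    (c T1 T2 x w : R) (omega : R -> R)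
    (hB : two_sided_brownian_motion B) (hc : 0 < c)
    (hQ : stationary_queue B c Q)
    (hT1 : 0 <= T1) (hT12 : T1 < T2) (hx : 0 <= x) (hxT : x < T2 - T1)
    (homega : omega u - (u + w) @[u --> +oo] --> (0 : R)) :
  cond_prob P'
      [set o | (x%:E < occupation_time T1 T2 (fun t => Q t o) (omega u))%E]
      [set o | (u%:E < Q 0%R o)%E]
    / (expR (- (2 * c * w)) * calC B c T1 T2 x w)
    @[u --> +oo] --> (1 : R).
Proof.
have H0 : 0 < T2 by exact: le_lt_trans hT12.
have T12 : 0 <= T1 < T2 by rewrite hT1.
have xT : 0 <= x < T2 - T1 by rewrite hx.
case: hQ => cQ lawQ.
(* both probabilities under the law of Q are computed for the workload *)
have joint u y : P' ([set o | (x%:E < occupation_time T1 T2 (fun t => Q t o) y)%E] `&`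
    [set o | (u%:E < Q 0%R o)%E]) = P (queue_event B c T1 T2 x u y).
  have := lawQ _ (path_measurable_queue_event T1 x u y H0).
  rewrite (_ : [set o | [set f | _] (workload B c ^~ o)] = queue_event B c T1 T2 x u y).
    move=> <-; congr (P' _); apply/seteqP; split=> o /= [h1 h2]; split=> //.
      apply/long_occupationP => //; apply: continuous_subspaceW (cQ o) => t /=.
      by rewrite !in_itv/= => /andP[h _]; rewrite (le_trans hT1).
    apply/long_occupationP => //; apply: continuous_subspaceW (cQ o) => t /=.
    by rewrite !in_itv/= => /andP[h _]; rewrite (le_trans hT1).
  have WE o : workload B c ^~ o = backlog (drifted B c ^~ o).
    by apply: funext => t; exact: workloadE.
  by rewrite /queue_event; apply/seteqP; split=> o /=; rewrite !workloadE WE.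
have marginal u : 0 <= u -> P' [set o | (u%:E < Q 0%R o)%E] = (expR (- (2 * c * u)))%:E.
  move=> u0; rewrite -(probability_workload_gt hB hc u0).
  have mC : path_measurable `[0, +oo[ [set f : R -> \bar R | (u%:E < f 0%R)%E].
    apply: sub_sigma_algebra; exists 0, `]u%:E, +oo[%classic; split.
    - by rewrite /= in_itv/= lexx.
    - exact: emeasurable_itv.
    - by apply/seteqP; split=> f; rewrite /= in_itv/= andbT.
  exact: lawQ mC.
pose l v := fine (limit_integral B c T1 T2 x v).
have lE v : (l v)%:E = limit_integral B c T1 T2 x v.
  by rewrite fineK// limit_integral_fin.
have l0 : 0 < l w by rewrite -lte_fin lE; exact: limit_integral_gt0.
have denom : expR (- (2 * c * w)) * calC B c T1 T2 x w = l w.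
  by rewrite /l (limit_integralE hB hc T12 xT).
rewrite denom.
pose rho u := fine (descent_probability B c T2 u).
have rhoE u : (rho u)%:E = descent_probability B c T2 u.
  by rewrite fineK//; exact: (descent_probability_fin c hB H0).
pose cp u := cond_prob P'
      [set o | (x%:E < occupation_time T1 T2 (fun t => Q t o) (omega u))%E]
      [set o | (u%:E < Q 0%R o)%E].
have cpE u : 0 <= u ->
    (expR (- (2 * c * u)) * cp u)%:E = P (queue_event B c T1 T2 x u (omega u)).
  move=> u0; rewrite /cp /cond_prob joint marginal//= mulrC divfK ?gt_eqF ?expR_gt0//.
  rewrite fineK// ge0_fin_numE ?measure_ge0//.
  rewrite (le_lt_trans (probability_le1 _ _)) ?ltry//.
  exact: measurable_queue_event.
have cp_le u : 0 <= u -> cp u <= l (omega u - u) + rho u.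
  move=> u0; have := queue_event_le hB hc T12 xT u (omega u).
  by rewrite -cpE// -lE -rhoE -EFinD -EFinM lee_fin ler_pM2l// expR_gt0.
have cp_ge u : 0 <= u -> l (omega u - u) <= cp u + (rho u + rho u).
  move=> u0; have := queue_event_ge hB hc T12 xT u (omega u).
  rewrite -cpE// -lE -rhoE. rewrite -!EFinD -!EFinM lee_fin -mulrDr.
  by rewrite ler_pM2l// expR_gt0.
have lip v v' : l v <= expR (2 * c * `|v - v'|) * l v'.
  by rewrite -lee_fin EFinM !lE; exact: limit_integral_lipschitz.
pose a u := expR (2 * c * `|omega u - u - w|).
have a1 : a u @[u --> +oo] --> (1 : R).
  have h0 : omega u - u - w @[u --> +oo] --> (0 : R).
    by under eq_fun do rewrite -addrA -opprD.
  have h1 : 2 * c * `|omega u - u - w| @[u --> +oo] --> 2 * c * `|0 : R|.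
    by apply: cvgMr; exact: cvg_norm.
  have := cvg_comp _ _ h1 (@continuous_expR R _).
  by rewrite normr0 mulr0 expR0.
apply/cvgrPdist_le => e e0.
have el : 0 < e * l w / 4 by rewrite !mulr_gt0.
have [M hM] := @descent_probability_small R d T P B c T2 hB H0 _ el.
have e2 : 0 < e / 2 by rewrite divr_gt0.
near=> u.
have u0 : 0 <= u by near: u; exact: nbhs_pinfty_ge.
have ae : `|1 - a u| <= e / 2 by near: u; move/cvgrPdist_le : a1; apply.
have rhou : rho u <= e * l w / 4.
  rewrite -lee_fin rhoE; apply: hM; near: u; apply: nbhs_pinfty_ge; exact: num_real.
have up := cp_le u u0; have lo := cp_ge u u0.
have l1 : l (omega u - u) <= a u * l w by exact: lip.
have l2 : l w <= a u * l (omega u - u) by rewrite /a distrC; exact: lip.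
have lv0 : 0 <= l (omega u - u).
  by rewrite -lee_fin lE; exact: limit_integral_ge0.
have a_le : a u <= 1 + e / 2.
  by move: ae; rewrite ler_norml => /andP[+ _]; rewrite lerNl opprB lerBlDl.
exact: (ratio_estimate e0 l0 lv0 a_le l1 l2 rhou up lo).
Unshelve. all: by end_near. Qed.
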